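(* For any online algorithm $\mathrm{ALG}$ for SPVT (given for each number $n$ of buyers) and any $\delta>0$, there exists $n_0$ such that for all $n\ge n_0$ there exists a buyer price vector $\boldsymbol X'=(X'_1,\dots,X'_n)\in\mathbb N^n$ with $X'_1>\dots>X'_n$ such that, when the seller's price is $0$, $$\frac{\mathrm{OPT}(\boldsymbol X')}{\mathrm{ALG}(\boldsymbol X')}\ge 1.76239-\delta,$$ where $\mathrm{OPT}(\boldsymbol X')$ is the weak offline optimum (and the ratio is $+\infty$ if $\mathrm{ALG}(\boldsymbol X')=0$).
   Context: SPVT (secretary problem variant trading): there are $n$ buyers with non-negative prices and one seller with a non-negative price (together: $n+1$ agents). The seller initially holds one item; the intermediary and the buyers hold none. The agents arrive one by one in a uniformly random order; on arrival an agent reveals its price and whether it is a buyer or the seller. On each arrival the intermediary must immediately and irrevocably decide whether to trade: it may buy the item from the seller when the seller arrives, and it may sell the item to an arriving buyer only if it currently holds it. The social welfare is the price of the agent finally holding the item ($0$ if the intermediary ends up with it). An online algorithm is a (possibly randomized) rule which, knowing $n$ but not the prices or the order in advance, makes each decision based only on what has been revealed so far. Here the seller's price is fixed to $0$, so an instance is given by the buyer price vector $\boldsymbol X=(X_1,\dots,X_n)$, with buyers labelled so that $X_1>\dots>X_n$. $\mathrm{ALG}(\boldsymbol X)$ is the expected social welfare achieved by the algorithm (over the random order and the algorithm's randomness). Weak offline optimum: for each arrival order, the offline algorithm knows the order and all prices in advance and makes the best feasible decisions for that order; $\mathrm{OPT}(\boldsymbol X)$ is the expectation of this optimum over the uniformly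 random order, which for seller's price $0$ equals $\sum_{i=1}^n\frac{X_i}{i(i+1)}$. *)

(* Defs.v *)
From HB Require Import structures.
From mathcomp Require Import all_boot all_order all_algebra all_fingroup.
From mathcomp Require Import all_classical all_reals all_analysis.

Set Implicit Arguments.
Unset Strict Implicit.
Unset Printing Implicit Defensive.

Import Order.TTheory GRing.Theory Num.Theory.

Local Open Scope ring_scope.

(* The n+1 agents are the elements of 'I_n.+1: agent [ord0] is the seller and
   agent [lift ord0 i] is the buyer i : 'I_n.  An arrival order is a permutation
   [s], where [s t] is the agent arriving at time t. *)

Definition agent_prices (R : realType) (n : nat) (seller : R) (X : 'I_n -> R) :
  'I_n.+1 -> R := fun a => oapp X seller (unlift ord0 a).

(* What an arriving agent reveals: whether it is the seller, and its price. *)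
Definition report (R : realType) (n : nat) (p : 'I_n.+1 -> R) (a : 'I_n.+1) :
  bool * R := (a == ord0, p a).

(* [Some a] means that agent a holds the item, [None] that the intermediary
   does.  The decision d to trade with the arriving agent a has no effect when
   that trade is infeasible. *)
Definition trade_step (n : nat) (d : bool) (a : 'I_n.+1)
    (h : option 'I_n.+1) : option 'I_n.+1 :=
  if ~~ d then h else
  match h with
  | None => if a == ord0 then None else Some a
  | Some b => if (a == ord0) && (b == ord0) then None else h
  end.

Definition final_holder (n : nat) (s : 'S_n.+1) (d : 'I_n.+1 -> bool) :
  option 'I_n.+1 :=
  foldl (fun h t => trade_step (d t) (s t) h) (Some ord0) (enum 'I_n.+1).

Definition social_welfare (R : realType) (n : nat) (p : 'I_n.+1 -> R)
    (s : 'S_n.+1) (d : 'I_n.+1 -> bool) : R :=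
  oapp p 0 (final_holder s d).

(* A randomized rule for a given number of buyers: a random seed is drawn, and
   each decision is a function of the seed and of the sequence of reports up to
   and including that of the arriving agent.  The rule's own past decisions are
   determined by the same data. *)
Record online_algorithm (R : realType) := OnlineAlgorithm {
  seed_display : measure_display ;
  seed : measurableType seed_display ;
  seed_law : probability seed R ;
  decide : seed -> seq (bool * R) -> bool ;
  measurable_decide : forall history : seq (bool * R),
    measurable [set w | decide w history]%classic
}.

Definition history (R : realType) (n : nat) (p : 'I_n.+1 -> R) (s : 'S_n.+1)
    (t : 'I_n.+1) : seq (bool * R) :=
  [seq report p (s u) | u <- take t.+1 (enum 'I_n.+1)].

Definition online_welfare (R : realType) (A : online_algorithm R) (n : nat)
    (p : 'I_n.+1 -> R) (s : 'S_n.+1) (w : seed A) : R :=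
  social_welfare p s (fun t => decide w (history p s t)).

Definition order_mean (R : realType) (n : nat) (f : 'S_n.+1 -> R) : R :=
  (\sum_(s : 'S_n.+1) f s) / (n.+1)`!%:R.

Definition alg_welfare (R : realType) (A : online_algorithm R) (n : nat)
    (p : 'I_n.+1 -> R) : R :=
  order_mean (fun s => \int[seed_law A]_w online_welfare p s w).

(* The weak offline optimum.  Prices are non-negative, so the default value 0
   of the maximum is harmless. *)
Definition offline_welfare (R : realType) (n : nat) (p : 'I_n.+1 -> R)
    (s : 'S_n.+1) : R :=
  \big[Num.max/0]_(d : {ffun 'I_n.+1 -> bool}) social_welfare p s d.

Definition opt_welfare (R : realType) (n : nat) (p : 'I_n.+1 -> R) : R :=
  order_mean (offline_welfare p).

Definition welfare_ratio (R : realType) (opt alg : R) : \bar R :=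
  if alg == 0 then +oo%E else (opt / alg)%:E.

(* Main.v *)
Require Import Defs.
From HB Require Import structures.
From mathcomp Require Import all_boot all_order all_algebra all_fingroup.
From mathcomp Require Import all_classical all_reals all_analysis.
From mathcomp Require Import zify ring lra.

Set Implicit Arguments.
Unset Strict Implicit.
Unset Printing Implicit Defensive.

Import Order.TTheory GRing.Theory Num.Theory.

Local Open Scope ring_scope.

(** Consider instances with [K] real buyers, at prices 46^(M+1), ..., 46^(M+K),
    all other buyers being dummies with negligible prices given by a
    permutation [z]; give weight 46^-(M+K) to each [K] in 1..L.  When [n] is much
    larger than [L], what has been seen does not tell whether the best real
    buyer so far is the best one.  For a fixed seed and [z], summing over the
    arrival orders and over [K] turns the algorithm into an optimal stopping
    problem, whose dynamic program is dominated by an explicit supersolution: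
    with c = 1/46 and t the elapsed fraction of time, waiting for the next record is
    worth ln((1 - c + c t) / t) / (1 - c), selling to a record is worth
    1 / (1 - c + c t), and selling becomes better near t = 0.366.  Integrating over the
    arrival time of the seller, the weighted welfare averages at most about 0.285784
    per value of [K], whereas the optimum is at least
    46^(M+K) (1/2 + c/6 + c^2/12 + c^3/20); the quotient exceeds 1.76239.  By averaging, one
    pair ([K], [z]) is bad for the algorithm. *)

(** The price of level [a] does not depend on [K]. While the best real buyer seen is [e], the
    reports are therefore the same for every [K >= e]: one history forces one decision for all of
    them, and sums over [K] become geometric series. The dummies must have distinct prices, which
    could reveal who has arrived; averaging over [z] makes their reports a fixed sequence in time.
    Why c is not tiny: as c tends to 0 the scheme compares 1/2 with 1/4 + exp(-2)/4, a ratio of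
    about 1.7616, just short of the goal. A positive c raises the optimum through the lower levels,
    but then a sale below the top can also pay; this extra gain, of order c^2/2, must be tracked,
    which is the purpose of the second term of the potential. At c = 1/46 the final comparison has a
    margin of about 2 * 10^-7 per value of [K], which dictates the precision of the constants and
    the size of [L]. *)

(** * A superharmonic potential *)

Section Psi.
Variable R : realFieldType.
Implicit Types (al y h : R) (k : nat -> R) (U : seq nat).

(* [U] lists the unseen agents below the current top, and [y ^+ size U] is the
   weight of their all arriving in the remaining fraction [y] of the time;
   [al] bounds the gain expected from new tops, [k j] the additional gain from
   the possibility of selling to [j]. *)
Definition Psi al k y U : R :=
  y ^+ size U * al + y ^+ (size U).-1 * \sum_(j <- U) k j.

Lemma exprD1_ge (y h : R) n : 0 <= y -> 0 <= h ->
  y ^+ n + n%:R * h * y ^+ n.-1 <= (y + h) ^+ n.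
Proof.
move=> y0 h0; elim: n => [|n IH]; first by rewrite !expr0 !mul0r addr0.
rewrite [leRHS]exprS; apply: (le_trans _ (ler_wpM2l _ IH)); last exact: addr_ge0.
have -> : n.+1.-1 = n by [].
case: n {IH} => [|n]; first by rewrite expr0 /=; lra.
have p0 : 0 <= y ^+ n by exact: exprn_ge0.
have n0 : (0:R) <= n.+1%:R by exact: ler0n.
rewrite /= -[n.+2%:R]natr1 !exprS.
have : 0 <= n.+1%:R * h * h * y ^+ n by rewrite !mulr_ge0.
lra.
Qed.

Lemma sum_rem k U : uniq U ->
  \sum_(j <- U) \sum_(i <- rem j U) k i = (size U).-1%:R * \sum_(j <- U) k j.
Proof.
move=> uU.
have -> : \sum_(j <- U) \sum_(i <- rem j U) k i =
          \sum_(j <- U) (\sum_(i <- U) k i - k j).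
  by apply: eq_big_seq => j jU; rewrite (big_rem j jU) /= addrAC subrr add0r.
rewrite sumrB big_const_seq count_predT iter_addr_0.
case: U uU => [|x U] _; first by rewrite !big_nil /= mulr0 subr0.
by rewrite /= mulrSr addrK mulr_natl.
Qed.

(** Superharmonicity: a slot of weight [h] receives one agent of [U] or leaves [U] unchanged. Both
    terms of [Psi] are powers of [y], and the first two terms of the binomial expansion of [y + h]
    produce this recursion. *)
Lemma Psi_step al k y h U : uniq U -> 0 <= y -> 0 <= h -> 0 <= al ->
  (forall j, 0 <= k j) ->
  Psi al k y U + h * \sum_(j <- U) Psi al k y (rem j U) <= Psi al k (y + h) U.
Proof.
move=> uU y0 h0 a0 k0.
have S0 : 0 <= \sum_(j <- U) k j by exact: sumr_ge0.
have -> : \sum_(j <- U) Psi al k y (rem j U) =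
    (size U)%:R * (y ^+ (size U).-1 * al) +
    y ^+ (size U).-2 * ((size U).-1%:R * \sum_(j <- U) k j).
  rewrite -sum_rem // mulr_sumr -[(size U)%:R * _]/_.
  have -> : (size U)%:R * (y ^+ (size U).-1 * al) =
            \sum_(j <- U) (y ^+ (size U).-1 * al).
    by rewrite big_const_seq count_predT iter_addr_0 mulr_natl.
  rewrite -big_split /=; apply: eq_big_seq => j jU.
  by rewrite /Psi size_rem.
have e1 := ler_wpM2r a0 (exprD1_ge (size U) y0 h0).
have e2 := ler_wpM2r S0 (exprD1_ge (size U).-1 y0 h0).
rewrite /Psi; lra.
Qed.

Lemma Psi_ge al k y U : 0 <= y -> (forall j, 0 <= k j) ->
  y ^+ size U * al <= Psi al k y U.
Proof.
by move=> y0 k0; rewrite /Psi lerDl mulr_ge0 ?exprn_ge0 ?sumr_ge0.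
Qed.

End Psi.

Lemma sum_geo_le (R : realFieldType) (q : R) (m n : nat) : 0 <= q < 1 ->
  \sum_(m <= i < n) q ^+ (i - m) <= (1 - q)^-1.
Proof.
move=> /andP[q0 q1]; rewrite -{1}[m]add0n big_addn.
under eq_bigr do rewrite addnK.
have p : 0 < 1 - q by rewrite subr_gt0.
rewrite -[leRHS]mul1r ler_pdivlMr // mulrC; move: (n - m)%N => k.
have -> : (1 - q) * \sum_(0 <= i < k) q ^+ i = 1 - q ^+ k.
  elim: k => [|k IH]; first by rewrite big_nil expr0 mulr0 subrr.
  by rewrite big_nat_recr //= mulrDr IH exprS; lra.
by rewrite lerBlDr lerDl exprn_ge0.
Qed.

Lemma uniq_levels U e x : uniq U -> all (fun j => (0 < j < e)%N) U ->
  uniq (U ++ iota e.+1 x).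
Proof.
move=> uU aU; rewrite cat_uniq uU iota_uniq andbT /=; apply/hasPn => i.
by rewrite mem_iota => /andP[ei _]; apply/negP => /(allP aU); lia.
Qed.

Lemma all_levels U e x : (e < x)%N -> all (fun j => (0 < j < e)%N) U ->
  all (fun j => (0 < j < x)%N) (U ++ iota e.+1 (x - e.+1)).
Proof.
move=> ex aU; rewrite all_cat; apply/andP; split; apply/allP => i.
  by move=> /(allP aU) /andP[-> ie] /=; lia.
by rewrite mem_iota; lia.
Qed.

Lemma all_levels_dist U e x : (e.+1 < x)%N -> all (fun j => (0 < j < e)%N) U ->
  all (fun j => (j + 1 <= x)%N) (U ++ iota e.+1 (x - e.+1)).
Proof.
move=> /ltnW ex /(all_levels ex); apply: sub_all => j; lia.
Qed.

Lemma all_levels_dist2 U e : all (fun j => (0 < j < e)%N) U ->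
  all (fun j => (j + 2 <= e.+1)%N) U.
Proof. by apply: sub_all => j; lia. Qed.

(** Here [x] will be an arriving new top, at most the hidden top [K]; after the exchange each [x]
    comes with a sum over [K >= x], to which the induction hypothesis for top [x] applies. *)
Lemma big_triangle (R : nmodType) e L (F : nat -> nat -> R) :
  \sum_(e <= K < L.+1) \sum_(x <- iota e.+1 (K - e)) F K x =
  \sum_(e.+1 <= x < L.+1) \sum_(x <= K < L.+1) F K x.
Proof.
transitivity (\sum_(e <= K < L.+1) \sum_(e.+1 <= x < L.+1 | (x <= K)%N) F K x).
  apply: eq_big_nat => K /andP[eK KL].
  have -> : iota e.+1 (K - e) = index_iota e.+1 K.+1 by rewrite /index_iota subSS.
  by rewrite (big_nat_widen _ K.+1 L.+1).
rewrite (exchange_big_dep_nat predT) //=.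
apply: eq_big_nat => x /andP[ex xL].
by rewrite (big_nat_widenl x e) 1?ltnW.
Qed.

(** * The game once the item is held *)

Section Game.
Variables (R : realFieldType) (T : Type) (D : seq T -> bool).
Variables (rs : T) (rb rd : nat -> T) (v : nat -> R) (c : R) (N : nat).

Definition tfrac (m : nat) : R := m%:R / N%:R.

(* Gain of the decision rule [D], in units of the price of the top agent [K],
   when it holds the item, [m] slots remain and [U] is the list of unseen real
   agents.  Filling a slot with a given agent has weight 1/N; after a sale the
   agents of [U] may arrive anywhere, whence the factor [(m / N) ^ size U], which
   overcounts since it lets them share slots. *)
Fixpoint holding_gain (K m : nat) (U : seq nat) (hist : seq T) : R :=
  if m is m'.+1 then
    (let h' := rcons hist (rd (size hist)) in
     if D h' then v (size hist) * c ^+ K * tfrac m' ^+ size U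
     else holding_gain K m' U h') +
    N%:R^-1 * \sum_(a <- U)
      (let h' := rcons hist (rb a) in
       if D h' then c ^+ (K - a) * tfrac m' ^+ (size U).-1
       else holding_gain K m' (rem a U) h')
  else 0.

Fixpoint waiting_gain (K m : nat) (U : seq nat) (hist : seq T) : R :=
  if m is m'.+1 then
    waiting_gain K m' U (rcons hist (rd (size hist))) +
    N%:R^-1 * \sum_(a <- U) waiting_gain K m' (rem a U) (rcons hist (rb a)) +
    N%:R^-1 * holding_gain K m' U (rcons hist rs)
  else 0.

Lemma tfrac_ge0 m : 0 <= tfrac m.
Proof. by rewrite divr_ge0 ?ler0n. Qed.

Lemma tfracS m : tfrac m.+1 = tfrac m + N%:R^-1.
Proof. by rewrite /tfrac -natr1 mulrDl mul1r. Qed.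

Lemma tfrac_lt1 m : (m < N)%N -> tfrac m < 1.
Proof.
move=> mN; have N0 : (0 : R) < N%:R by rewrite ltr0n (leq_ltn_trans _ mN).
by rewrite ltr_pdivrMr // mul1r ltr_nat.
Qed.

Lemma rem_cat_notin (x : nat) s1 s2 : x \notin s1 -> rem x (s1 ++ s2) = s1 ++ rem x s2.
Proof.
elim: s1 => //= y s IH; rewrite inE negb_or eq_sym => /andP[/negbTE-> /IH ->] //.
Qed.

Lemma rem_cat_in (x : nat) s1 s2 : x \in s1 -> rem x (s1 ++ s2) = rem x s1 ++ s2.
Proof.
elim: s1 => //= y s IH; rewrite inE eq_sym; case: eqP => //= _ /IH -> //.
Qed.

Lemma rem_iota_cat (U : seq nat) e x K : all (fun j => (j < e)%N) U ->
  (e < x <= K)%N ->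
  rem x (U ++ iota e.+1 (K - e)) =
  (U ++ iota e.+1 (x - e.+1)) ++ iota x.+1 (K - x).
Proof.
move=> /allP aU /andP[ex xK].
have -> : (K - e = (x - e.+1) + (1 + (K - x)))%N by lia.
rewrite iotaD catA iotaD subnKC //= rem_cat_notin /= ?eqxx ?addn1 //.
rewrite mem_cat mem_iota subnKC // ltnn andbF orbF.
by apply/negP => /aU; rewrite ltnNge ltnW.
Qed.

(* [a m] bounds the gain expected from new tops, [kap j m] the one from an unseen
   agent [j] levels below the top, and [M1 m] (resp. [M2 m]) the gain when a new top
   arrives one level (resp. at least two levels) above the old one. *)
Variables (L : nat) (eta : R) (a : nat -> R) (kap : nat -> nat -> R).
Variables (th : nat -> nat -> R) (M1 M2 : nat -> R).
Local Notation h := (N%:R^-1 : R).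
Local Notation y := tfrac.
Let A m := (1 - c * y m)^-1.

Hypothesis c01 : 0 <= c < 1.
Hypothesis v_le : forall i, 0 <= v i <= eta.
Hypothesis a0 : forall m, (m < N)%N -> eta * A m <= a m.
Hypothesis kap_ge0 : forall j m, 0 <= kap j m.
Hypothesis th_ge0 : forall j m, 0 <= th j m.
Hypothesis kap_th : forall j m, (0 < j <= L)%N -> kap j m <= y m * th j m.
Hypothesis kap_step : forall j m, (0 < j <= L)%N -> (m.+1 < N)%N ->
  kap j m + h * Num.max 0 (c ^+ j * A m - a m) <= kap j m.+1.
Hypothesis M1A : forall m, (m < N)%N -> A m <= M1 m.
Hypothesis M2A : forall m, (m < N)%N -> A m <= M2 m.
Hypothesis M1a : forall m, (m < N)%N ->
  a m + \sum_(2 <= j < L.+1) th j m <= M1 m.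
Hypothesis M2a : forall m, (m < N)%N ->
  a m + \sum_(1 <= j < L.+1) th j m <= M2 m.
(** A new top [i + 1] levels up leaves [i] more agents unseen below it and so carries weight
    [y ^ i]; the geometric sum over [i >= 1] is the factor [y / (1 - y)]. *)
Hypothesis a_step : forall m, (m.+1 < N)%N ->
  a m + h * (M1 m + y m / (1 - y m) * M2 m) <= a m.+1.

Lemma cy_bounds m : (m < N)%N -> 0 <= c * y m < 1.
Proof.
move=> mN; have /andP[c0 c1] := c01; have y0 := tfrac_ge0 m; have y1 := tfrac_lt1 mN.
rewrite mulr_ge0 //= (le_lt_trans _ y1) // ler_piMl // ltW //.
Qed.

(** No level above the top [e] has been seen, so if the true top is [K], the [K - e] levels above
    [e] must all arrive in the remaining fraction: a geometric series of ratio [c * y]. *)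
Lemma sale_sum m e x u : (m < N)%N -> (x <= e)%N ->
  \sum_(e <= K < L.+1) c ^+ (K - x) * y m ^+ (u + (K - e)) <=
  c ^+ (e - x) * y m ^+ u * A m.
Proof.
move=> mN xe.
have -> : \sum_(e <= K < L.+1) c ^+ (K - x) * y m ^+ (u + (K - e)) =
   c ^+ (e - x) * y m ^+ u * \sum_(e <= K < L.+1) (c * y m) ^+ (K - e).
  rewrite mulr_sumr; apply: eq_big_nat => K /andP[eK _].
  have -> : (K - x = (e - x) + (K - e))%N by clear -xe eK; lia.
  rewrite [(c * y m) ^+ _]exprMn !exprD; ring.
apply: ler_wpM2l; last exact: sum_geo_le (cy_bounds mN).
by have /andP[? _] := c01; rewrite mulr_ge0 ?exprn_ge0 ?tfrac_ge0.
Qed.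

Lemma A_ge0 m : (m < N)%N -> 0 <= A m.
Proof. by move=> /cy_bounds /andP[_ h1]; rewrite invr_ge0 subr_ge0 ltW. Qed.

Lemma a_ge0 m : (m < N)%N -> 0 <= a m.
Proof.
move=> mN; apply: le_trans (a0 mN); rewrite mulr_ge0 ?A_ge0 //.
by have /andP[p q] := v_le 0; exact: le_trans p q.
Qed.

Lemma sum_levels (f : nat -> R) (s : seq nat) (k x : nat) :
  (forall j, 0 <= f j) -> uniq s -> all (fun j => (j + k <= x)%N) s -> (x <= L)%N ->
  all (fun j => (0 < j)%N) s -> (0 < k)%N ->
  \sum_(j <- s) f (x - j)%N <= \sum_(k <= j < L.+1) f j.
Proof.
move=> f0 us /allP ak xL /allP a1 k0.
have -> : \sum_(j <- s) f (x - j)%N = \sum_(i <- [seq (x - j)%N | j <- s]) f i.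
  by rewrite big_map.
have us' : uniq [seq (x - j)%N | j <- s].
  rewrite map_inj_in_uniq // => i j /ak hi /ak hj; clear -hi hj k0; lia.
have sub : {subset [seq (x - j)%N | j <- s] <= index_iota k L.+1}.
  move=> i /mapP[j js ->]; rewrite mem_index_iota.
  by have := ak _ js; have := a1 _ js; clear -xL k0; lia.
rewrite [leRHS](bigID (fun i => i \in [seq (x - j)%N | j <- s])) /=.
rewrite -[X in _ <= X + _]big_filter.
rewrite [X in _ <= X + _](perm_big [seq (x - j)%N | j <- s]) /=;
  last first.
  apply: uniq_perm; rewrite ?filter_uniq ?iota_uniq // => i.
  by rewrite mem_filter; apply: andb_idr => /sub.
by rewrite lerDl sumr_ge0.
Qed.

(** All [K >= e] share [hist], so [D] decides alike for all of them. By induction on the slots, each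
    arrival is covered whatever the decision: a dummy by [a0], an agent below the top by the growth
    of [kap], a new top by the growth of [a]. *)
Lemma sum_holding_gain_le m e U hist : (m < N)%N -> (e <= L)%N -> uniq U ->
  all (fun j => (0 < j < e)%N) U ->
  \sum_(e <= K < L.+1) holding_gain K m (U ++ iota e.+1 (K - e)) hist <=
  Psi (a m) (fun j => kap (e - j) m) (y m) U.
Proof.
elim: m e U hist => [|m IH] e U hist mN eL uU aU.
  rewrite big1 // (le_trans _ (Psi_ge _ _ _ _)) ?tfrac_ge0 //.
  by rewrite mulr_ge0 ?exprn_ge0 ?tfrac_ge0 ?a_ge0.
have m'N : (m < N)%N by exact: ltnW.
have y0 := tfrac_ge0 m; have h0 : 0 <= h by rewrite invr_ge0 ler0n.
have /andP[c0 c1] := c01.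
set u := size U.
set P := Psi (a m) (fun j => kap (e - j) m) (y m).
have aU' : all (fun j => (j < e)%N) U by apply: sub_all aU => j /andP[].
rewrite /= big_split /= -mulr_sumr.
(* [t1], [t2], [t3]: the next arrival is a dummy, an agent below the top [e],
   a new top [x]. *)
have t1 : \sum_(e <= K < L.+1)
   (if D (rcons hist (rd (size hist)))
    then v (size hist) * c ^+ K * y m ^+ size (U ++ iota e.+1 (K - e))
    else holding_gain K m (U ++ iota e.+1 (K - e)) (rcons hist (rd (size hist)))) <= P U.
  case: (D _); last exact: IH.
  apply: (@le_trans _ _ (y m ^+ u * (eta * A m))); last first.
    apply: le_trans (Psi_ge _ _ _ _) => //.
    by rewrite ler_wpM2l ?exprn_ge0 ?a0.
  have /andP[v0 v1] := v_le (size hist).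
  apply: (@le_trans _ _ (v (size hist) *
     \sum_(e <= K < L.+1) c ^+ (K - 0) * y m ^+ (u + (K - e)))).
    rewrite mulr_sumr ler_sum // => K _.
    by rewrite subn0 size_cat size_iota mulrA.
  apply: le_trans (ler_wpM2l v0 (sale_sum u m'N (leq0n e))) _.
  have A0 := A_ge0 m'N.
  have p0 : 0 <= y m ^+ u by exact: exprn_ge0.
  have q0 : 0 <= c ^+ (e - 0) by exact: exprn_ge0.
  have q1 : c ^+ (e - 0) <= 1 by rewrite exprn_ile1 // ltW //.
  have -> : v (size hist) * (c ^+ (e - 0) * y m ^+ u * A m) =
    c ^+ (e - 0) * (y m ^+ u * (v (size hist) * A m)) by ring.
  apply: le_trans (ler_piMl _ q1) _; first by rewrite !mulr_ge0.
  by rewrite ler_wpM2l // ler_wpM2r.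
have t2 : \sum_(e <= K < L.+1) \sum_(j <- U)
   (if D (rcons hist (rb j))
    then c ^+ (K - j) * y m ^+ (size (U ++ iota e.+1 (K - e))).-1
    else holding_gain K m (rem j (U ++ iota e.+1 (K - e))) (rcons hist (rb j))) <=
   \sum_(j <- U) (P (rem j U) + y m ^+ u.-1 * Num.max 0 (c ^+ (e - j) * A m - a m)).
  rewrite exchange_big /= big_seq [leRHS]big_seq ler_sum // => j jU.
  have /andP[j0 je] := allP aU _ jU.
  have u0 : (0 < u)%N by rewrite /u; case: (U) jU.
  case: (D _).
    apply: (@le_trans _ _ (\sum_(e <= K < L.+1) c ^+ (K - j) * y m ^+ (u.-1 + (K - e)))).
      apply: ler_sum => K _; rewrite size_cat size_iota -/u.
      by have -> : (u + (K - e)).-1 = (u.-1 + (K - e))%N by clear -u0; lia.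
    apply: le_trans (sale_sum _ m'N (ltnW je)) _.
    have := Psi_ge (a m) (rem j U) y0 (fun i => kap_ge0 (e - i) m).
    rewrite size_rem // -/u -/P => p1.
    have p2 : c ^+ (e - j) * A m - a m <= Num.max 0 (c ^+ (e - j) * A m - a m).
      by rewrite le_max lexx orbT.
    have p0 : 0 <= y m ^+ u.-1 by exact: exprn_ge0.
    by have := ler_wpM2l p0 p2; lra.
  apply: (@le_trans _ _ (P (rem j U))); last first.
    by rewrite lerDl mulr_ge0 ?exprn_ge0 // le_max lexx.
  apply: le_trans (IH e (rem j U) (rcons hist (rb j)) m'N eL (rem_uniq _ uU) _); last first.
    by apply/allP => i /mem_rem /(allP aU).
  by apply: ler_sum => K _; rewrite rem_cat_in.
have t3 : \sum_(e <= K < L.+1) \sum_(x <- iota e.+1 (K - e))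
   (if D (rcons hist (rb x))
    then c ^+ (K - x) * y m ^+ (size (U ++ iota e.+1 (K - e))).-1
    else holding_gain K m (rem x (U ++ iota e.+1 (K - e))) (rcons hist (rb x))) <=
   y m ^+ u * (M1 m + y m / (1 - y m) * M2 m).
  pose F K x := if D (rcons hist (rb x))
    then c ^+ (K - x) * y m ^+ (size (U ++ iota e.+1 (K - e))).-1
    else holding_gain K m (rem x (U ++ iota e.+1 (K - e))) (rcons hist (rb x)).
  change (\sum_(e <= K < L.+1) \sum_(x <- iota e.+1 (K - e)) F K x <=
    y m ^+ u * (M1 m + y m / (1 - y m) * M2 m)).
  rewrite big_triangle.
  have tx x : (e < x < L.+1)%N -> \sum_(x <= K < L.+1) F K x <=
     y m ^+ (u + (x - e.+1)) * (if x == e.+1 then M1 m else M2 m).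
    move=> /andP[ex xL]; rewrite /F; case: (D _).
      apply: (@le_trans _ _ (\sum_(x <= K < L.+1)
         c ^+ (K - x) * y m ^+ ((u + (x - e.+1)) + (K - x)))).
        rewrite !big_nat ler_sum // => K /andP[xK KL]; rewrite size_cat size_iota -/u.
        by have -> : ((u + (K - e)).-1 = u + (x - e.+1) + (K - x))%N by clear -ex xK; lia.
      apply: le_trans (sale_sum _ m'N (leqnn x)) _.
      rewrite subnn expr0 mul1r ler_wpM2l ?exprn_ge0 //.
      by case: ifP => _; [exact: M1A|exact: M2A].
    set V := U ++ iota e.+1 (x - e.+1).
    apply: (@le_trans _ _ (Psi (a m) (fun j => kap (x - j) m) (y m) V)).
      apply: le_trans (IH x V (rcons hist (rb x)) m'N xL _ _).
      - rewrite big_nat [leRHS]big_nat ler_sum // => K /andP[xK KL].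
        by rewrite (rem_iota_cat aU') // ex -ltnS.
      - exact: uniq_levels.
      - exact: all_levels.
    have sV : size V = (u + (x - e.+1))%N by rewrite size_cat size_iota.
    rewrite -sV; set M := (if _ then _ else _).
    have kth : \sum_(j <- V) kap (x - j) m <= y m * \sum_(j <- V) th (x - j) m.
      rewrite mulr_sumr big_seq [leRHS]big_seq ler_sum // => j.
      move=> /(allP (all_levels ex aU)) jx; apply: kap_th.
      by clear -jx xL; lia.
    have aV : all (fun j => (0 < j)%N) V.
      by apply: sub_all (all_levels ex aU) => j /andP[].
    have uV : uniq V by exact: uniq_levels.
    have aM : a m + \sum_(j <- V) th (x - j) m <= M.
      (* If [x = e + 1], the unseen lower agents are those of [U], at least two levels below [x];
         otherwise level [x - 1] is unseen too and the sum must start at 1. *)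
      rewrite /M; case: eqP => xe.
        apply: le_trans (M1a m'N); rewrite lerD2l; apply: sum_levels => //.
        by rewrite /V xe subnn cats0; exact: all_levels_dist2.
      apply: le_trans (M2a m'N); rewrite lerD2l; apply: sum_levels => //.
      by apply: all_levels_dist => //; clear -ex xe; lia.
    rewrite /Psi.
    have p0 : 0 <= y m ^+ size V by exact: exprn_ge0.
    apply: le_trans (ler_wpM2l p0 aM); rewrite mulrDr lerD2l.
    case: (V) kth => [|i V'] kth; first by rewrite !big_nil !mulr0.
    rewrite [size _]/= [X in _ <= X * _]exprS.
    apply: le_trans (ler_wpM2l (exprn_ge0 (size V') y0) kth) _.
    by rewrite le_eqVlt; apply/orP; left; apply/eqP; ring.
  apply: le_trans (_ : \sum_(e.+1 <= x < L.+1)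
     y m ^+ (u + (x - e.+1)) * (if x == e.+1 then M1 m else M2 m) <= _).
    by rewrite big_nat [leRHS]big_nat ler_sum.
  have y1 := tfrac_lt1 m'N.
  have A0 := A_ge0 m'N.
  have M10 : 0 <= M1 m := le_trans A0 (M1A m'N).
  have M20 : 0 <= M2 m := le_trans A0 (M2A m'N).
  have q0 : 0 <= y m / (1 - y m) by rewrite divr_ge0 // subr_ge0 ltW //.
  have [Le|eL'] := leqP L e.
    by rewrite big_geq // mulr_ge0 ?exprn_ge0 // addr_ge0 // mulr_ge0.
  rewrite big_ltn // eqxx subnn addn0 mulrDr lerD2l.
  have -> : \sum_(e.+2 <= i < L.+1) y m ^+ (u + (i - e.+1)) *
      (if i == e.+1 then M1 m else M2 m) =
     y m ^+ u * (y m * (\sum_(e.+2 <= i < L.+1) y m ^+ (i - e.+2)) * M2 m).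
    rewrite mulr_sumr mulr_suml mulr_sumr; apply: eq_big_nat => i /andP[ei _].
    have -> : (i == e.+1) = false by clear -ei; lia.
    have -> : (i - e.+1 = (i - e.+2).+1)%N by clear -ei; lia.
    by rewrite exprD exprS; ring.
  rewrite ler_wpM2l ?exprn_ge0 // ler_wpM2r // ler_wpM2l // sum_geo_le //.
  by rewrite y0.
have {t2 t3} t23 : \sum_(e <= K < L.+1) \sum_(j <- U ++ iota e.+1 (K - e))
   (if D (rcons hist (rb j))
    then c ^+ (K - j) * y m ^+ (size (U ++ iota e.+1 (K - e))).-1
    else holding_gain K m (rem j (U ++ iota e.+1 (K - e))) (rcons hist (rb j))) <=
   \sum_(j <- U) P (rem j U) +
   y m ^+ u.-1 * \sum_(j <- U) Num.max 0 (c ^+ (e - j) * A m - a m) +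
   y m ^+ u * (M1 m + y m / (1 - y m) * M2 m).
  under eq_bigr do rewrite big_cat /=.
  rewrite big_split /= [y m ^+ u.-1 * _]mulr_sumr -[X in _ <= X + _]big_split /=.
  exact: lerD.
apply: le_trans (lerD t1 (ler_wpM2l h0 t23)) _.
have st := Psi_step uU y0 h0 (a_ge0 m'N) (fun i => kap_ge0 (e - i) m).
rewrite tfracS.
have w0 : 0 <= y m + h by rewrite addr_ge0.
have yy : y m <= y m + h by rewrite lerDl.
have e1 : y m ^+ u * (h * (M1 m + y m / (1 - y m) * M2 m)) <=
          (y m + h) ^+ u * (a m.+1 - a m).
  have := a_step mN => as'.
  have B0 : 0 <= a m.+1 - a m - h * (M1 m + y m / (1 - y m) * M2 m) by lra.
  have z0 : 0 <= h * (M1 m + y m / (1 - y m) * M2 m).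
    have y1 := tfrac_lt1 m'N.
    have A0 := A_ge0 m'N.
    have M10 : 0 <= M1 m := le_trans A0 (M1A m'N).
    have M20 : 0 <= M2 m := le_trans A0 (M2A m'N).
    by rewrite mulr_ge0 // addr_ge0 // mulr_ge0 // divr_ge0 // subr_ge0 ltW //.
  apply: ler_pM; rewrite ?exprn_ge0 //; last lra.
  by apply: lerXn2r; rewrite ?nnegrE.
have e2 : y m ^+ u.-1 * (h * \sum_(j <- U) Num.max 0 (c ^+ (e - j) * A m - a m)) <=
   (y m + h) ^+ u.-1 * (\sum_(j <- U) kap (e - j) m.+1 - \sum_(j <- U) kap (e - j) m).
  apply: ler_pM; rewrite ?exprn_ge0 //.
  - by rewrite mulr_ge0 // sumr_ge0 // => j _; rewrite le_max lexx.
  - by apply: lerXn2r; rewrite ?nnegrE.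
  rewrite mulr_sumr -sumrB big_seq [leRHS]big_seq ler_sum // => j jU.
  have /andP[j0 je] := allP aU _ jU.
  by have := @kap_step (e - j) m _ mN; rewrite lerBrDl; apply; clear -j0 je eL; lia.
move: st; rewrite -/P {2}/Psi [leRHS]/Psi -/u; lra.
Qed.

End Game.

(** * Before the seller arrives *)

Section PhaseA.
Variables (R : realFieldType) (T : Type) (D : seq T -> bool).
Variables (rs : T) (rb rd : nat -> T) (v : nat -> R) (c : R) (N L : nat).
Local Notation holding_gain := (holding_gain D rb rd v c N).
Local Notation waiting_gain := (waiting_gain D rs rb rd v c N).
Local Notation y := (@tfrac R N).
Local Notation h := (N%:R^-1 : R).

(** A sale is worth at most 1. This crude bound will cap the potential while no real buyer has been
    seen. *)
Lemma holding_gain_le_tfrac K m U hist : 0 <= c <= 1 -> (forall i, 0 <= v i <= 1) ->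
  uniq U -> holding_gain K m U hist <= y m ^+ size U.
Proof.
move=> /andP[c0 c1] v01; elim: m U hist => [|m IH] U hist uU.
  by rewrite exprn_ge0 ?tfrac_ge0.
have h0 : 0 <= h by rewrite invr_ge0 ler0n.
have y0 := tfrac_ge0 R N m.
have PE t V : Psi 1 (fun=> 0) t V = t ^+ size V :> R.
  by rewrite /Psi big1 // mulr0 addr0 mulr1.
rewrite tfracS -PE.
have st := Psi_step uU y0 h0 ler01 (fun _ : nat => lexx (0 : R)).
apply: le_trans st => /=.
apply: lerD.
  rewrite PE; case: (D _); last exact: IH.
  have /andP[v0 v1] := v01 (size hist).
  by rewrite ler_piMl ?exprn_ge0 // mulr_ile1 ?exprn_ge0 ?exprn_ile1.
rewrite ler_wpM2l // big_seq [leRHS]big_seq ler_sum // => j jU.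
rewrite PE size_rem //; case: (D _).
  by rewrite ler_piMl ?exprn_ge0 // exprn_ile1.
by rewrite -(size_rem jU) IH // rem_uniq.
Qed.

Variables (al : nat -> nat -> R) (kap : nat -> nat -> R).
Hypothesis al_ge0 : forall e m, (m < N)%N -> 0 <= al e m.
Hypothesis kap_ge0 : forall j m, 0 <= kap j m.
Hypothesis holding_le : forall m e U hist, (m < N)%N -> (e <= L)%N -> uniq U ->
  all (fun j => (0 < j < e)%N) U ->
  \sum_(e <= K < L.+1) holding_gain K m (U ++ iota e.+1 (K - e)) hist <=
  Psi (al e m) (fun j => kap (e - j) m) (y m) U.

(* If the seller comes when [m0] slots remain, the top at that time is either the
   current top [e] or some [x > e] arriving in between, with weight
   [y m - y m0]. *)
Definition future_top m0 e t U : R := Psi (al e m0) (fun j => kap (e - j) m0) t U.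

Definition seller_val m0 m e U : R := future_top m0 e (y m) U +
  \sum_(e.+1 <= x < L.+1)
     (y m - y m0) * future_top m0 x (y m) (U ++ iota e.+1 (x - e.+1)).

Lemma future_top_step m0 m e U : (m0 < N)%N -> uniq U ->
  future_top m0 e (y m) U + h * \sum_(j <- U) future_top m0 e (y m) (rem j U)
  <= future_top m0 e (y m.+1) U.
Proof.
move=> m0N uU; rewrite tfracS.
by apply: Psi_step => //; rewrite ?tfrac_ge0 ?invr_ge0 ?ler0n ?al_ge0.
Qed.

Lemma future_top_ge0 m0 e m U : (m0 < N)%N -> 0 <= future_top m0 e (y m) U.
Proof.
move=> m0N; apply: le_trans (Psi_ge _ _ _ _); rewrite ?tfrac_ge0 //.
by rewrite mulr_ge0 ?exprn_ge0 ?tfrac_ge0 ?al_ge0.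
Qed.

Lemma tfrac_mono m m' : (m <= m')%N -> y m <= y m'.
Proof. by move=> mm; rewrite ler_wpM2r ?invr_ge0 ?ler0n // ler_nat. Qed.

(** For a fixed slot of the seller, [seller_val] is superharmonic in the earlier slots: [future_top]
    is so by [Psi_step], and the growth by [h] of the factor [y m - y m0] accounts for the slot
    being filled by the new top [x] itself. *)
Lemma seller_val_step m0 m e U : (m0 <= m)%N -> (m < N)%N ->
  uniq U -> all (fun j => (0 < j < e)%N) U ->
  seller_val m0 m e U + h * \sum_(j <- U) seller_val m0 m e (rem j U) +
  h * \sum_(e.+1 <= x < L.+1) seller_val m0 m x (U ++ iota e.+1 (x - e.+1))
  <= seller_val m0 m.+1 e U.
Proof.
move=> m0m mN uU aU; have m0N : (m0 < N)%N by exact: leq_ltn_trans mN.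
have h0 : 0 <= h by rewrite invr_ge0 ler0n.
have aU' : all (fun j => (j < e)%N) U by apply: sub_all aU => j /andP[].
pose V x := U ++ iota e.+1 (x - e.+1).
pose d := y m - y m0; have d0 : 0 <= d by rewrite subr_ge0 tfrac_mono.
have E1 := future_top_step m e m0N uU.
have E2 : \sum_(e.+1 <= x < L.+1) (d * (future_top m0 x (y m) (V x) +
     h * \sum_(j <- V x) future_top m0 x (y m) (rem j (V x)))
      + h * future_top m0 x (y m) (V x)) <=
   \sum_(e.+1 <= x < L.+1) (y m.+1 - y m0) * future_top m0 x (y m.+1) (V x).
  rewrite big_nat [leRHS]big_nat ler_sum // => x /andP[ex xL].
  have st := future_top_step m x m0N (uniq_levels (x - e.+1) uU aU).
  have s0 : 0 <= \sum_(j <- V x) future_top m0 x (y m) (rem j (V x)).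
    by apply: sumr_ge0 => j _; exact: future_top_ge0.
  have -> : y m.+1 - y m0 = d + h by rewrite tfracS /d; ring.
  have q := ler_wpM2l d0 st; have q' := ler_wpM2l h0 st.
  have q2 := mulr_ge0 h0 (mulr_ge0 h0 s0).
  move: q q' q2; rewrite -/(V x); lra.
(* The agent removed from [V x] is either in [U] or a level strictly between [e] and [x], that is,
   an intermediate top reached before [x]. *)
have E3 : \sum_(e.+1 <= x < L.+1) \sum_(j <- V x) future_top m0 x (y m) (rem j (V x)) =
   \sum_(j <- U) \sum_(e.+1 <= x < L.+1)
      future_top m0 x (y m) (rem j U ++ iota e.+1 (x - e.+1)) +
   \sum_(e.+1 <= x < L.+1) \sum_(x.+1 <= x' < L.+1)
      future_top m0 x' (y m) (V x ++ iota x.+1 (x' - x.+1)).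
  rewrite [X in _ = X + _]exchange_big /=.
  transitivity (\sum_(e.+1 <= x < L.+1)
    (\sum_(j <- U) future_top m0 x (y m) (rem j U ++ iota e.+1 (x - e.+1)) +
     \sum_(x' <- iota e.+1 (x - e.+1))
        future_top m0 x (y m) (V x' ++ iota x'.+1 (x - x'.+1)))).
    apply: eq_big_nat => x /andP[ex xL]; rewrite {1}/V big_cat /=; congr (_ + _).
      by apply: eq_big_seq => j jU; rewrite /V rem_cat_in.
    apply: eq_big_seq => j; rewrite mem_iota => jx.
    rewrite /V; have -> : (x - e.+1 = x.-1 - e)%N by clear; lia.
    rewrite (rem_iota_cat aU'); last by clear -jx ex; lia.
    by have -> : (x.-1 - j = x - j.+1)%N by clear; lia.
  rewrite big_split /=; congr (_ + _).
  pose F x x' := future_top m0 x (y m) (V x' ++ iota x'.+1 (x - x'.+1)).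
  have big_shift : \sum_(e.+1 <= x < L.+1) \sum_(x' <- iota e.+1 (x - e.+1)) F x x' =
     \sum_(e.+1 <= x' < L.+1) \sum_(x'.+1 <= x < L.+1) F x x'.
    transitivity (\sum_(e.+1 <= x < L.+1) \sum_(e.+1 <= x' < L.+1 | (x' < x)%N) F x x').
      apply: eq_big_nat => K /andP[eK KL].
      by rewrite (big_nat_widen _ K L.+1) // ltnW.
    rewrite (exchange_big_dep_nat predT) //=.
    apply: eq_big_nat => x /andP[ex xL].
    by rewrite (big_nat_widenl x.+1 e.+1) //; exact: ltnW.
  exact: big_shift.
move: E2; rewrite big_split /= -!mulr_sumr big_split /= -mulr_sumr E3 => E2.
have S1 : \sum_(j <- U) seller_val m0 m e (rem j U) =
  \sum_(j <- U) future_top m0 e (y m) (rem j U) + d * \sum_(j <- U)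
   \sum_(e.+1 <= x < L.+1) future_top m0 x (y m) (rem j U ++ iota e.+1 (x - e.+1)).
  by rewrite mulr_sumr -[RHS]big_split; apply: eq_bigr => j _; rewrite mulr_sumr.
have S2 : \sum_(e.+1 <= x < L.+1) seller_val m0 m x (V x) =
  \sum_(e.+1 <= x < L.+1) future_top m0 x (y m) (V x) + d *
   \sum_(e.+1 <= x < L.+1) \sum_(x.+1 <= x' < L.+1)
      future_top m0 x' (y m) (V x ++ iota x.+1 (x' - x.+1)).
  by rewrite mulr_sumr -[RHS]big_split; apply: eq_bigr => j _; rewrite mulr_sumr.
rewrite S1 S2 /seller_val -!mulr_sumr -/d.
by move: E1 E2; rewrite /V; lra.
Qed.

Lemma seller_val_now m e U : (m < N)%N -> uniq U -> all (fun j => (0 < j < e)%N) U ->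
  future_top m e (y m) U <= seller_val m m.+1 e U.
Proof.
move=> mN uU aU; have h0 : 0 <= h by rewrite invr_ge0 ler0n.
apply: le_trans (_ : future_top m e (y m.+1) U <= _).
  apply: le_trans (future_top_step m e mN uU); rewrite lerDl mulr_ge0 //.
  by apply: sumr_ge0 => j _; exact: future_top_ge0.
rewrite lerDl sumr_ge0 // => x _; rewrite mulr_ge0 ?future_top_ge0 //.
by rewrite subr_ge0 tfrac_mono.
Qed.

(** Decisions before the seller comes have no effect, so the gain is additive over the possible
    slots of the seller: each has weight [h] and its own superharmonic function. *)
Lemma sum_waiting_gain_le m e U hist : (m <= N)%N -> (e <= L)%N -> uniq U ->
  all (fun j => (0 < j < e)%N) U ->
  \sum_(e <= K < L.+1) waiting_gain K m (U ++ iota e.+1 (K - e)) hist <=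
  h * \sum_(0 <= m0 < m) seller_val m0 m e U.
Proof.
elim: m e U hist => [|m IH] e U hist mN eL uU aU.
  by rewrite big1 // big_geq // mulr0.
have h0 : 0 <= h by rewrite invr_ge0 ler0n.
have m'N : (m <= N)%N by exact: ltnW.
have aU' : all (fun j => (j < e)%N) U by apply: sub_all aU => j /andP[].
rewrite [leLHS]big_split /= [X in X + _ <= _]big_split /= -!mulr_sumr.
have t1 := IH e U (rcons hist (rd (size hist))) m'N eL uU aU.
have t4 := holding_le (rcons hist rs) mN eL uU aU.
have t2 : \sum_(e <= K < L.+1) \sum_(j <- U)
    waiting_gain K m (rem j (U ++ iota e.+1 (K - e))) (rcons hist (rb j)) <=
    \sum_(j <- U) (h * \sum_(0 <= m0 < m) seller_val m0 m e (rem j U)).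
  rewrite exchange_big /= big_seq [leRHS]big_seq ler_sum // => j jU.
  have aR : all (fun j => (0 < j < e)%N) (rem j U).
    by apply/allP => i /mem_rem /(allP aU).
  apply: le_trans (IH e (rem j U) (rcons hist (rb j)) m'N eL (rem_uniq _ uU) aR).
  by apply: ler_sum => K _; rewrite rem_cat_in.
have t3 : \sum_(e <= K < L.+1) \sum_(x <- iota e.+1 (K - e))
    waiting_gain K m (rem x (U ++ iota e.+1 (K - e))) (rcons hist (rb x)) <=
    \sum_(e.+1 <= x < L.+1)
      (h * \sum_(0 <= m0 < m) seller_val m0 m x (U ++ iota e.+1 (x - e.+1))).
  rewrite big_triangle big_nat [leRHS]big_nat ler_sum // => x /andP[ex xL].
  apply: le_trans (IH x _ (rcons hist (rb x)) m'N xL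
    (uniq_levels _ uU aU) (all_levels ex aU)).
  rewrite big_nat [leRHS]big_nat ler_sum // => K /andP[xK KL].
  by rewrite (rem_iota_cat aU') // ex -ltnS.
have -> : \sum_(e <= K < L.+1) \sum_(j <- U ++ iota e.+1 (K - e))
    waiting_gain K m (rem j (U ++ iota e.+1 (K - e))) (rcons hist (rb j)) =
   \sum_(e <= K < L.+1) \sum_(j <- U)
    waiting_gain K m (rem j (U ++ iota e.+1 (K - e))) (rcons hist (rb j)) +
   \sum_(e <= K < L.+1) \sum_(x <- iota e.+1 (K - e))
    waiting_gain K m (rem x (U ++ iota e.+1 (K - e))) (rcons hist (rb x)).
  by rewrite -big_split; apply: eq_bigr => K _; rewrite big_cat.
rewrite [X in _ <= h * X]big_nat_recr //= [leRHS]mulrDr.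
have t5 := seller_val_now mN uU aU.
apply: lerD; last by rewrite ler_wpM2l // (le_trans t4).
apply: le_trans (lerD t1 (ler_wpM2l h0 (lerD t2 t3))) _.
rewrite -!mulr_sumr -mulrDr -mulrDr ler_wpM2l //.
rewrite [X in _ + h * (X + _)]exchange_big [X in _ + h * (_ + X)]exchange_big /=.
rewrite -big_split mulr_sumr -big_split /=.
rewrite big_nat [leRHS]big_nat ler_sum // => m0 /andP[_ m0m].
by rewrite mulrDr addrA; apply: seller_val_step => //; exact: ltnW.
Qed.

End PhaseA.

(** * Arrival orders as words *)

Section Link.
Variables (n K : nat).
Local Notation N := n.+1.
Hypothesis Kn : (K <= n)%N.

(* Agent [0] is the seller, [1..K] are the real buyers by increasing price;
   a dummy has level [None], so that [word] hides which dummy arrives. *)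
Definition level (a : 'I_N) : option nat := if (a <= K)%N then Some (a : nat) else None.

Definition word (s : 'S_N) : seq (option nat) := [seq level (s t) | t <- enum 'I_N].

Lemma size_word s : size (word s) = N.
Proof. by rewrite size_map size_enum_ord. Qed.

Lemma nth_word s (t : 'I_N) : nth None (word s) t = level (s t).
Proof. by rewrite (nth_map t) ?size_enum_ord // nth_ord_enum. Qed.

Lemma word_uniq s i j a : (i < N)%N -> (j < N)%N ->
  nth None (word s) i = Some a -> nth None (word s) j = Some a -> i = j.
Proof.
move=> iN jN; rewrite -[i]/(val (Ordinal iN)) -[j]/(val (Ordinal jN)) !nth_word /level.
case: ifP => // _ [ei]; case: ifP => // _ [ej].
by congr val; apply: (@perm_inj _ s); apply: val_inj; rewrite /= ei ej.
Qed.

Lemma mem_word s a : (a <= K)%N -> Some a \in word s.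
Proof.
move=> aK; have aN : (a < N)%N by rewrite ltnS (leq_trans aK).
apply/mapP; exists ((s^-1)%g (Ordinal aN)); first by rewrite mem_enum.
by rewrite permKV /level /= aK.
Qed.

Lemma nth_word_le s i a : nth None (word s) i = Some a -> (a <= K)%N.
Proof.
move=> E; have : Some a \in word s.
  rewrite -E mem_nth // size_word ltnNge; apply/negP => Ni.
  by rewrite nth_default ?size_word in E.
by case/mapP => t _; rewrite /level; case: ifP => // h [->].
Qed.

Definition agrees (om : seq (option nat)) (s : 'S_N) := take (size om) (word s) == om.

Lemma agrees_rcons om x s : (size om < N)%N ->
  agrees (rcons om x) s = agrees om s && (nth None (word s) (size om) == x).
Proof.
by move=> h; rewrite /agrees size_rcons (take_nth None) ?size_word // eqseq_rcons.
Qed.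

Lemma agrees_fresh om s a : (size om < N)%N -> agrees om s ->
  nth None (word s) (size om) = Some a -> Some a \notin om.
Proof.
move=> h /eqP E W; apply/negP; rewrite -{1}E => /(nthP None)[i].
rewrite size_takel ?size_word ?(ltnW h) // => io.
rewrite nth_take // => V; have := word_uniq _ h V W.
by move=> /(_ (ltn_trans io h)) ei; rewrite ei ltnn in io.
Qed.

Definition unseen (om : seq (option nat)) (V : seq nat) :=
  uniq V /\ forall a, (a \in V) = (a <= K)%N && (Some a \notin om).

Lemma unseen_rem om V a : unseen om V -> a \in V -> unseen (rcons om (Some a)) (rem a V).
Proof.
move=> [uV hV] aV; split; first exact: rem_uniq.
move=> x; rewrite mem_rem_uniq // !inE hV mem_rcons inE negb_or.
have -> : (Some x == Some a :> option nat) = (x == a).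
  by apply/eqP/eqP => [[]|->].
by rewrite andbCA.
Qed.

Lemma unseen_none om V : unseen om V -> unseen (rcons om None) V.
Proof. by move=> [uV hV]; split => // x; rewrite hV mem_rcons inE. Qed.

Lemma sum_agrees (R : nmodType) om V (F : 'S_N -> R) : (size om < N)%N -> unseen om V ->
  \sum_(s | agrees om s) F s =
  \sum_(s | agrees (rcons om None) s) F s +
  \sum_(a <- V) \sum_(s | agrees (rcons om (Some a)) s) F s.
Proof.
move=> h [uV hV].
transitivity (\sum_(x <- None :: [seq Some a | a <- V])
    \sum_(s | agrees (rcons om x) s) F s); last by rewrite big_cons big_map.
under [RHS]eq_bigr => x _ do under eq_bigl => s do rewrite agrees_rcons //.
rewrite (exchange_big_dep (agrees om)) /=; last by move=> x s _ /andP[].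
apply: eq_bigr => s As; under eq_bigl => x do rewrite As eq_sym.
rewrite -big_filter filter_pred1_uniq ?big_seq1 //.
  by rewrite /= map_inj_uniq ?uV ?andbT; [apply/mapP => -[]|move=> x y []].
case E : (nth _ _ _) => [a|]; last by rewrite inE.
rewrite inE; apply/orP; right; apply: map_f; rewrite hV (nth_word_le E).
exact: agrees_fresh h As E.
Qed.

Lemma unseen_full om V s : size om = N -> unseen om V -> agrees om s -> V = [::].
Proof.
move=> So [uV hV] /eqP; rewrite take_oversize ?size_word ?So // => W.
case: V uV hV => // a V _ hV; have := hV a; rewrite inE eqxx /= => /esym /andP[aK].
by rewrite -W mem_word.
Qed.

Lemma same_word s s0 : word s = word s0 ->
  (s0^-1 * s)%g \in perm_on [set a : 'I_N | (K < a)%N].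
Proof.
move=> W; rewrite unfold_in; apply/fintype.subsetP => a.
rewrite !inE permM ltnNge; apply: contraNN => aK.
have := nth_word s ((s0^-1)%g a); rewrite W nth_word permKV /level aK.
by case: ifP => // _ [] /val_inj <-.
Qed.

(** The agents of [V] choose among [m] remaining slots, sharing allowed; interchanging the dummies
    gives the factor (n - K)!. The induction rests on [m ^ v + v * m ^ (v - 1) <= (m + 1) ^ v], the
    inequality already behind [Psi_step]. *)
Lemma card_agrees om V m : (size om + m = N)%N -> unseen om V ->
  (#|[pred s | agrees om s]| <= (n - K)`! * m ^ size V)%N.
Proof.
elim: m om V => [|m IH] om V.
  rewrite addn0 => So uV.
  case: (pickP [pred s | agrees om s]) => [s0 /= A0|A0]; last by rewrite eq_card0.
  rewrite (unseen_full So uV A0) expn0 muln1.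
  have <- : #|[set a : 'I_N | (K < a)%N]| = (n - K)%N.
    have := cardsC [set a : 'I_N | (K < a)%N]; rewrite card_ord.
    have -> : ~: [set a : 'I_N | (K < a)%N] = [set widen_ord (Kn : (K < N)%N) i | i : 'I_K.+1].
      apply/setP => a; rewrite !inE -leqNgt; apply/idP/imsetP => [aK|[i _ ->]].
        by exists (Ordinal (aK : (a < K.+1)%N)) => //; apply: val_inj.
      by rewrite /= -ltnS.
    rewrite card_imset ?card_ord; first by move=> h; rewrite -(addnK K.+1 #|_|) h subSS.
    by move=> i j /(congr1 val) /= /val_inj.
  rewrite -card_perm; pose f s := (s0^-1 * s)%g.
  rewrite -(@card_imset _ _ f [pred s | agrees om s]); last exact: mulgI.
  apply/subset_leq_card/fintype.subsetP => _ /imsetP[s As ->]; apply: same_word.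
  move: As A0; rewrite inE /agrees !take_oversize ?size_word ?So //.
  by move=> /eqP-> /eqP->.
move=> Nm uV; have h : (size om < N)%N by rewrite -Nm -addSnnS leq_addr.
have IH0 : (#|[pred s | agrees (rcons om None) s]| <= (n - K)`! * m ^ size V)%N.
  by apply: IH; [rewrite size_rcons addSnnS|exact: unseen_none].
have IHa a : a \in V ->
   (#|[pred s | agrees (rcons om (Some a)) s]| <= (n - K)`! * m ^ (size V).-1)%N.
  move=> aV; rewrite -(size_rem aV).
  by apply: IH; [rewrite size_rcons addSnnS|exact: unseen_rem].
have := sum_agrees (fun=> 1%N) h uV; rewrite !sum1_card => ->.
under eq_bigr do rewrite sum1_card.
apply: (@leq_trans ((n - K)`! * (m ^ size V + size V * m ^ (size V).-1))); last first.
  rewrite leq_mul2l; apply/orP; right.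
  have := @exprD1_ge rat m%:R 1 (size V) (ler0n _ _) ler01.
  by rewrite mulr1 natr1 -!natrX -natrM -natrD ler_nat.
rewrite mulnDr leq_add //.
apply: leq_trans (_ : \sum_(a <- V) (n - K)`! * m ^ (size V).-1 <= _)%N.
  by rewrite big_seq [X in (_ <= X)%N]big_seq leq_sum.
by rewrite big_const_seq count_predT iter_addn_0 -mulnA [(m ^ _ * _)%N]mulnC.
Qed.

Section Run.
Variables (R : realFieldType) (T : Type) (D : seq T -> bool).
Variables (rs : T) (rb rd : nat -> T) (v : nat -> R) (c : R).
Hypothesis c0 : 0 <= c.
Hypothesis v0 : forall i, 0 <= v i.
Local Notation holding_gain := (holding_gain D rb rd v c N K).
Local Notation waiting_gain := (waiting_gain D rs rb rd v c N K).

Definition report_at i (o : option nat) : T :=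
  if o is Some a then (if a == 0%N then rs else rb a) else rd i.

(** In units of the top price: level [a] lies [K - a] factors below the top, and [v i] is expressed
    in the price that level 0 would have. *)
Definition sale i (o : option nat) : R :=
  if o is Some a then c ^+ (K - a) else v i * c ^+ K.

Fixpoint run_holding (W : seq (option nat)) (hist : seq T) : R :=
  if W is o :: W' then
    let h' := rcons hist (report_at (size hist) o) in
    if D h' then sale (size hist) o else run_holding W' h'
  else 0.

Fixpoint run_waiting (W : seq (option nat)) (hist : seq T) : R :=
  if W is o :: W' then
    let h' := rcons hist (report_at (size hist) o) in
    if o == Some 0%N then run_holding W' h' else run_waiting W' h'
  else 0.

Lemma drop_agrees om x s : (size om < N)%N -> agrees (rcons om x) s ->
  drop (size om) (word s) = x :: drop (size (rcons om x)) (word s).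
Proof.
move=> h; rewrite agrees_rcons // => /andP[_ /eqP <-].
by rewrite size_rcons -drop_nth // size_word.
Qed.

Lemma N_neq0 : (N%:R : R) != 0. Proof. by rewrite pnatr_eq0. Qed.

Lemma cancelN (a b x : R) : a * (b * N%:R) * (N%:R^-1 * x) = a * b * x.
Proof. by rewrite [a * (b * _)]mulrA -mulrA (mulrA N%:R) mulfV ?mul1r ?N_neq0. Qed.

Lemma sum_sale om U m (x : R) : 0 <= x -> (size om + m = N)%N -> unseen om U ->
  \sum_(s | agrees om s) x <=
  (n - K)`!%:R * N%:R ^+ size U * (x * tfrac R N m ^+ size U).
Proof.
move=> x0 Nm uU; rewrite sumr_const -[leLHS]mulr_natl.
have -> : (n - K)`!%:R * N%:R ^+ size U * (x * tfrac R N m ^+ size U) =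
   ((n - K)`! * m ^ size U)%N%:R * x.
  rewrite /tfrac expr_div_n natrM natrX; field.
  by rewrite expf_eq0 negb_and N_neq0 orbT.
by rewrite ler_wpM2r // ler_nat card_agrees.
Qed.

(** Dividing by (n - K)! N^|U| turns the counts of [card_agrees] into weights 1 / N per slot filled
    by a real buyer, the scale of [holding_gain]. *)
Lemma sum_run_holding_le m om U hist : (size om + m = N)%N -> unseen om U -> 0%N \notin U ->
  \sum_(s | agrees om s) run_holding (drop (size om) (word s)) hist <=
  (n - K)`!%:R * N%:R ^+ size U * holding_gain m U hist.
Proof.
elim: m om U hist => [|m IH] om U hist Nm uU U0.
  rewrite big1 ?mulr0 // => s _; rewrite drop_oversize // size_word -Nm addn0 //.
have h : (size om < N)%N by rewrite -Nm -addSnnS leq_addr.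
rewrite (sum_agrees _ h uU) /= mulrDr; apply: lerD.
  under eq_bigr => s As do rewrite (drop_agrees h As) /=.
  case: (D _); last by apply: IH; rewrite ?size_rcons ?addSnnS //; exact: unseen_none.
  apply: sum_sale; rewrite ?size_rcons ?addSnnS //; last exact: unseen_none.
  by rewrite mulr_ge0 ?exprn_ge0.
rewrite mulr_sumr mulr_sumr big_seq [leRHS]big_seq ler_sum // => a aU.
have a0 : a != 0%N by apply: contraNneq U0 => <-.
have uU' := unseen_rem uU aU.
have NU : N%:R ^+ size U = N%:R ^+ size (rem a U) * N%:R :> R.
  by rewrite (size_rem aU) -exprSr prednK //; case: (U) aU.
under eq_bigr => s As do rewrite (drop_agrees h As) /= (negbTE a0).
rewrite NU.
set X := (if D _ then _ else _) in |- *.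
have -> : (n - K)`!%:R * (N%:R ^+ size (rem a U) * N%:R) * (N%:R^-1 * X) =
    (n - K)`!%:R * N%:R ^+ size (rem a U) * X :> R by exact: cancelN.
rewrite {}/X; case: (D _).
  rewrite -(size_rem aU).
  by apply: sum_sale; rewrite ?size_rcons ?addSnnS ?exprn_ge0.
apply: IH; rewrite ?size_rcons ?addSnnS //.
by apply: contra U0 => /mem_rem.
Qed.

Lemma sum_run_waiting_le m om U hist : (size om + m = N)%N -> unseen om (0%N :: U) ->
  \sum_(s | agrees om s) run_waiting (drop (size om) (word s)) hist <=
  (n - K)`!%:R * N%:R ^+ (size U).+1 * waiting_gain m U hist.
Proof.
elim: m om U hist => [|m IH] om U hist Nm uU.
  rewrite big1 ?mulr0 // => s _; rewrite drop_oversize // size_word -Nm addn0 //.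
have h : (size om < N)%N by rewrite -Nm -addSnnS leq_addr.
have U0 : 0%N \notin U by case: uU => /= /andP[].
rewrite (sum_agrees _ h uU) big_cons /= !mulrDr addrA addrAC.
apply: lerD; last first.
  have uU' := unseen_rem uU (mem_head _ _).
  rewrite /= in uU'.
  under eq_bigr => s As do rewrite (drop_agrees h As) /=.
  have -> : (n - K)`!%:R * N%:R ^+ (size U).+1 * (N%:R^-1 * holding_gain m U (rcons hist rs)) =
     (n - K)`!%:R * N%:R ^+ (size U) * holding_gain m U (rcons hist rs) :> R.
    by rewrite exprSr cancelN.
  by apply: sum_run_holding_le; rewrite ?size_rcons ?addSnnS.
apply: lerD.
  under eq_bigr => s As do rewrite (drop_agrees h As) /=.
  by apply: IH; rewrite ?size_rcons ?addSnnS //; exact: unseen_none.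
rewrite mulr_sumr mulr_sumr big_seq [leRHS]big_seq ler_sum // => a aU.
have a0 : a != 0%N by apply: contraNneq U0 => <-.
have aU0 : a \in 0%N :: U by rewrite inE aU orbT.
have uU' := unseen_rem uU aU0.
rewrite /= eq_sym (negbTE a0) in uU'.
have NU : N%:R ^+ (size U).+1 = N%:R ^+ (size (rem a U)).+1 * N%:R :> R.
  by rewrite (size_rem aU) -exprSr prednK //; case: (U) aU.
have e0 : (Some a == Some 0%N :> option nat) = false.
  by apply/eqP => -[] E; rewrite E eqxx in a0.
under eq_bigr => s As do rewrite (drop_agrees h As) /= e0 (negbTE a0).
rewrite NU; set X := waiting_gain _ _ _ in |- *.
have -> : (n - K)`!%:R * (N%:R ^+ (size (rem a U)).+1 * N%:R) * (N%:R^-1 * X) =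
    (n - K)`!%:R * N%:R ^+ (size (rem a U)).+1 * X :> R by exact: cancelN.
by apply: IH; rewrite ?size_rcons ?addSnnS.
Qed.

Lemma sum_run_word_le : \sum_(s : 'S_N) run_waiting (word s) [::] <=
  (n - K)`!%:R * N%:R ^+ K.+1 * waiting_gain N (iota 1 K) [::].
Proof.
have := @sum_run_waiting_le N [::] (iota 1 K) [::]; rewrite size_iota /=.
have -> : \sum_(s | agrees [::] s) run_waiting (drop 0 (word s)) [::] =
  \sum_(s : 'S_N) run_waiting (word s) [::].
  by apply: eq_big => [s|s _]; rewrite ?drop0 // /agrees take0 eqxx.
apply => //; split; first exact: (iota_uniq 0 K.+1).
by move=> a; rewrite -/(iota 0 K.+1) mem_iota add0n ltnS andbT.
Qed.

End Run.
End Link.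

(** * Welfare as a run over a word *)

Section Welfare.
Variables (R : realType) (n K M b : nat) (A : online_algorithm R) (w : seed A).
Local Notation N := n.+1.
Hypothesis b0 : (0 < b)%N.

(** Buyer prices have to be strictly ordered, so the dummies get distinct prices; being at most [n],
    these are negligible once [b ^ M] is much larger than [n]. *)
Definition hard_price (z : 'S_N) (a : 'I_N) : nat :=
  if a == ord0 then 0%N else if (a <= K)%N then (b ^ (M + a))%N else z a.

Definition dummy_report (z : 'S_N) (i : nat) : bool * R :=
  (false, (z (inord i) : nat)%:R).

Definition dummy_value (z : 'S_N) (i : nat) : R := (z (inord i) : nat)%:R / b%:R ^+ M.

Definition level_report (a : nat) : bool * R := (false, (b ^ (M + a))%:R).

Definition seller_report : bool * R := (true, 0).

Variables (z s : 'S_N).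
Let p (a : 'I_N) : R := (hard_price z a)%:R.
Let d (t : 'I_N) := decide w (history p s t).
Let seen (pre : seq 'I_N) := [seq report p (s u) | u <- pre].
Let rep := report_at seller_report level_report (dummy_report (s * z)%g).
Let sl := sale K (dummy_value (s * z)%g) (b%:R^-1 : R).
Local Notation rH := (run_holding K (decide w) seller_report level_report
   (dummy_report (s * z)%g)
   (dummy_value (s * z)%g) (b%:R^-1)).
Local Notation rW := (run_waiting K (decide w) seller_report level_report
   (dummy_report (s * z)%g)
   (dummy_value (s * z)%g) (b%:R^-1)).
Let stp (h : option 'I_N) (t : 'I_N) := trade_step (d t) (s t) h.
Let lv (t : 'I_N) := level K (s t).

Lemma enum_size pre (t : 'I_N) l : enum 'I_N = pre ++ t :: l -> (t : nat) = size pre.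
Proof.
move=> E; have sN : (size pre < N)%N.
  by have := size_enum_ord N; rewrite E size_cat /=; lia.
have := nth_enum_ord t sN; rewrite E nth_cat ltnn subnn /= => H.
exact: H.
Qed.

Lemma history_pre pre t l : enum 'I_N = pre ++ t :: l ->
  history p s t = rcons (seen pre) (report p (s t)).
Proof.
move=> E; rewrite /history E (enum_size E) -cat_rcons take_cat.
rewrite size_rcons ltnn subnn take0 cats0.
by rewrite map_rcons.
Qed.

Lemma report_level pre t l : enum 'I_N = pre ++ t :: l ->
  report p (s t) = rep (size pre) (level K (s t)).
Proof.
move=> E; rewrite -(enum_size E) /rep /report /report_at /p /hard_price /level.
case: eqP => [->|/eqP s0] //.
case: ifP => [sK|_]; last by rewrite /dummy_report inord_val permM.
by case: eqP => // E0; case/eqP: s0; apply: val_inj.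
Qed.

Lemma price_sale pre t l : enum 'I_N = pre ++ t :: l -> s t != ord0 ->
  p (s t) = b%:R ^+ (M + K) * sl (size pre) (level K (s t)).
Proof.
move=> E s0; have bn : b%:R != 0 :> R by rewrite pnatr_eq0 -lt0n.
rewrite -(enum_size E) /sl /sale /p /hard_price /level (negbTE s0).
case: ifP => [sK|_].
  have -> : (M + K = M + s t + (K - s t))%N by rewrite -addnA subnKC.
  rewrite natrX exprVn [b%:R ^+ (_ + (K - _))]exprD mulfK //.
  by rewrite expf_eq0 (negbTE bn) andbF.
rewrite /dummy_value inord_val permM exprVn exprD.
by field; rewrite !expf_eq0 (negbTE bn) !andbF.
Qed.

Lemma fold_sold (x : 'I_N) l : x != ord0 -> foldl stp (Some x) l = Some x.
Proof.
move=> x0; elim: l => //= t l IH; rewrite {2}/stp /trade_step (negbTE x0) andbF.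
by case: (~~ _).
Qed.

Lemma size_seen pre : size (seen pre) = size pre. Proof. exact: size_map. Qed.

Lemma fold_holding pre l : enum 'I_N = pre ++ l -> ord0 \notin [seq s t | t <- l] ->
  oapp p 0 (foldl stp None l) = b%:R ^+ (M + K) * rH (map lv l) (seen pre).
Proof.
elim: l pre => [|t l IH] pre E; first by rewrite /= mulr0.
rewrite /= inE negb_or => /andP[t0 l0]; rewrite eq_sym in t0.
rewrite size_seen -/(rep _ _) -(report_level E) {2}/stp /d (history_pre E).
have E' : enum 'I_N = rcons pre t ++ l by rewrite cat_rcons.
case: (decide w _).
  by rewrite /trade_step (negbTE t0) /= fold_sold //= (price_sale E).
by rewrite /trade_step /= (IH _ E' l0) /seen map_rcons.
Qed.

(** Only an inequality: [run_waiting] always takes the item from the seller, whereas a rule that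
    declines it ends with welfare 0, the seller's price. *)
Lemma fold_start pre l : enum 'I_N = pre ++ l ->
  oapp p 0 (foldl stp (Some ord0) l) <= b%:R ^+ (M + K) * rW (map lv l) (seen pre).
Proof.
have bM : 0 <= b%:R ^+ (M + K) :> R by rewrite exprn_ge0.
have p0 : p ord0 = 0 by rewrite /p /hard_price eqxx.
elim: l pre => [|t l IH] pre E; first by rewrite /= mulr0 p0.
have E' : enum 'I_N = rcons pre t ++ l by rewrite cat_rcons.
rewrite /= size_seen -/(rep _ _) -(report_level E) {2}/stp.
have -> : (level K (s t) == Some 0%N) = (s t == ord0).
  rewrite /level; case: ifP => [sK|/negbT sK]; last first.
    by apply/esym/negbTE; apply: contraNneq sK => ->.
  by apply/eqP/eqP => [[] h|->] //; apply: val_inj.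
case: eqP => [st0|/eqP st0]; last first.
  rewrite /trade_step (negbTE st0) /=.
  have -> : (if ~~ d t then Some ord0 else Some ord0) = Some (ord0 : 'I_N) by case: ifP.
  by rewrite (le_trans (IH _ E')) // /seen map_rcons.
have l0 : ord0 \notin [seq s t0 | t0 <- l].
  have := enum_uniq 'I_N; rewrite E cat_uniq /= => /and4P[_ _ tl _].
  by rewrite -st0 mem_map //; exact: perm_inj.
have FB := fold_holding E' l0; rewrite /seen map_rcons in FB; rewrite -FB.
rewrite /trade_step st0 eqxx /=; case: (d t) => //=.
have -> : foldl stp (Some ord0) l = Some (ord0 : 'I_N).
  elim: (l) l0 => //= t' l' IH'; rewrite inE negb_or eq_sym => /andP[t'0 /IH'].
  by rewrite {3}/stp /trade_step (negbTE t'0) /=; case: (~~ _).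
rewrite /= p0; case: (foldl _ _ _) => [a|] //=; exact: ler0n.
Qed.

Lemma online_welfare_le_run :
  online_welfare p s w <= b%:R ^+ (M + K) * rW (word K s) [::].
Proof. exact: (@fold_start [::] (enum 'I_N)). Qed.

End Welfare.

Section WelfareSum.
Variables (R : realType) (n K M b : nat) (A : online_algorithm R) (w : seed A).
Local Notation N := n.+1.
Hypothesis b0 : (0 < b)%N.
Hypothesis Kn : (K <= n)%N.

(* Reindexing [z] by [s] turns dummy prices attached to agents into dummy prices
   attached to times. *)
Lemma sum_welfare_le :
  \sum_(z : 'S_N) \sum_(s : 'S_N)
     online_welfare (fun a => (hard_price K M b z a)%:R) s w <=
  b%:R ^+ (M + K) * ((n - K)`!%:R * N%:R ^+ K.+1) *
  \sum_(z : 'S_N) waiting_gain (decide w) (seller_report R) (level_report R M b)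
     (dummy_report R z) (dummy_value R M b z) b%:R^-1 N K N (iota 1 K) [::].
Proof.
pose rn (z s : 'S_N) := run_waiting K (decide w) (seller_report R) (level_report R M b)
   (dummy_report R z) (dummy_value R M b z) b%:R^-1 (word K s) [::].
apply: (@le_trans _ _ (\sum_(z : 'S_N) \sum_(s : 'S_N) b%:R ^+ (M + K) * rn (s * z)%g s)).
  by apply: ler_sum => z _; apply: ler_sum => s _; exact: online_welfare_le_run.
have -> : \sum_(z : 'S_N) \sum_(s : 'S_N) b%:R ^+ (M + K) * rn (s * z)%g s =
  b%:R ^+ (M + K) * \sum_(z : 'S_N) \sum_(s : 'S_N) rn z s.
  rewrite mulr_sumr exchange_big.
  rewrite [X in _ = X](eq_bigr (fun z => \sum_(s : 'S_N) b%:R ^+ (M + K) * rn z s)).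
    rewrite [RHS]exchange_big; apply: eq_bigr => s _.
    by rewrite [RHS](reindex_inj (mulgI s)).
  by move=> z _; rewrite mulr_sumr.
rewrite -mulrA ler_wpM2l ?exprn_ge0 // mulr_sumr ler_sum // => z _.
apply: sum_run_word_le => // i; rewrite /dummy_value ?invr_ge0 ?divr_ge0 ?exprn_ge0 //.
Qed.
End WelfareSum.

(** * The value of waiting for a record *)

Section Value.
Variable R : realType.
Implicit Types s t : R.
Local Notation c := (46^-1 : R).

Lemma expR_ge_partial (x : R) n : 0 <= x ->
  \sum_(0 <= k < n) x ^+ k / k`!%:R <= expR x.
Proof.
move=> x0; rewrite /expR.
apply: (@nondecreasing_cvgn_le _ (series (exp_coeff x)) _ _ n).
  apply/nondecreasing_seqP => m; rewrite /series /= big_nat_recr //= lerDl.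
  by rewrite /exp_coeff /= divr_ge0 ?exprn_ge0 ?ler0n.
exact: is_cvg_series_exp_coeff.
Qed.

(* At time [t], selling to a record is worth [(disc t)^-1], the sum over [i] of
   [(c * (1 - t)) ^+ i]: when [i] higher levels exist, they must all be still to
   come, and the price relative to theirs is [c ^+ i].  Waiting for the next record is
   worth [stopval t], the integral from [t] to 1 of [(s * disc s)^-1]. *)
Definition disc t : R := 1 - c * (1 - t).
Definition stopval t : R := ln (disc t / t) / (1 - c).

Lemma disc_gt0 t : 0 <= t -> 0 < disc t.
Proof. by rewrite /disc; lra. Qed.

Lemma ratio_gt0 t : 0 < t -> 0 < disc t / t.
Proof. by move=> t0; rewrite divr_gt0 // disc_gt0 // ltW. Qed.

Lemma ln_le_sub1 (x : R) : 0 < x -> ln x <= x - 1.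
Proof.
move=> x0; have -> : ln x = ln (1 + (x - 1)) by congr ln; ring.
by apply: le_ln1Dx; lra.
Qed.

(** [ln x <= x - 1], applied to the quotient of the two arguments of [ln]. With [s] and [t]
    exchanged the estimate also gives a lower bound; together they replace differentiating
    [stopval]. *)
Lemma stopval_sub_le s t : 0 < s -> 0 < t ->
  stopval s - stopval t <= (t - s) / (s * disc t).
Proof.
move=> s0 t0; rewrite /stopval -mulrBl -ln_div ?posrE ?ratio_gt0 //.
have ds := disc_gt0 (ltW s0); have dt := disc_gt0 (ltW t0).
have := ln_le_sub1 (divr_gt0 (ratio_gt0 s0) (ratio_gt0 t0)).
have -> : disc s / s / (disc t / t) - 1 = (1 - c) * ((t - s) / (s * disc t)).
  move: dt; rewrite /disc => dt; field.
  by rewrite !gt_eqF //; lra.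
move=> H; rewrite ler_pdivrMr; last lra.
by rewrite [leRHS]mulrC.
Qed.

Lemma stopval_sub_ge s t : 0 < s -> s <= t ->
  (t - s) / (t * disc t) <= stopval s - stopval t.
Proof.
move=> s0 st; have t0 := lt_le_trans s0 st.
have ds := disc_gt0 (ltW s0); have dt := disc_gt0 (ltW t0).
have := stopval_sub_le t0 s0; rewrite -lerN2 !opprB -mulNr opprB.
apply: le_trans; rewrite ler_wpM2l ?subr_ge0 //.
rewrite lef_pV2 ?posrE ?mulr_gt0 // ler_wpM2l ?(ltW t0) //.
by rewrite /disc; lra.
Qed.

Lemma stopval1 : stopval 1 = 0.
Proof. by rewrite /stopval /disc subrr mulr0 subr0 divr1 ln1 mul0r. Qed.

Lemma stopval_ge t : 0 < t <= 1 -> (1 - t) / disc t <= stopval t.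
Proof.
move=> /andP[t0 t1]; have := stopval_sub_le ltr01 t0; rewrite stopval1 mul1r.
by rewrite sub0r -lerN2 opprK -mulNr opprB.
Qed.

Lemma expR_ge_horner (x : R) : 0 <= x ->
  1 + x / 1 * (1 + x / 2 * (1 + x / 3 * (1 + x / 4 * (1 + x / 5 * (1 + x / 6 *
    (1 + x / 7 * (1 + x / 8 * (1 + x / 9 * (1 + x / 10 * (1 + x / 11 * (1 + x / 12 * 1))))))))))) <= expR x.
Proof.
move=> /(expR_ge_partial 13); apply: le_trans.
(* Hiding the factorial behind its recursion lets the denominators unfold into products of small
   numerals. *)
have [F [F0 FS FE]] : exists F : nat -> R, [/\ F 0%N = 1,
    forall k, F k.+1 = k.+1%:R * F k & forall k, k`!%:R = F k].
  by exists (fun k => k`!%:R); split => // k; rewrite factS natrM.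
under eq_bigr do rewrite FE.
rewrite !big_nat_recr //= big_nil !FS F0; lra.
Qed.

Lemma stopval_ts : stopval (131 / 358) <=
  1 + 134 / 10 ^+ 4 + 87 / 10 ^+ 6 + 85 / 10 ^+ 8.
Proof.
rewrite /stopval ler_pdivrMr; last lra.
have t0 : 0 < 131 / 358 :> R by lra.
rewrite -ler_expR lnK ?posrE ?ratio_gt0 //.
apply: le_trans (expR_ge_horner _); last lra.
rewrite /disc; lra.
Qed.
End Value.

(** * The supersolution *)

Section Potential.
Variable R : realType.
Implicit Types s t h y : R.
(* [ts] is slightly later than the solution of [stopval t = (disc t)^-1], which
   leaves room for [stot], the total gain expected from lower levels; [rho] is the
   part of [stot] that is not due to the level just below the top, and [ubar]
   majorizes [stopval ts].  The bump of height [sig * w] pays for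
   the excess, at most [sig], of [(disc t)^-1] over [bst / t - kk] on the window
   between [t1] and [ts]. *)
Local Notation c := (46^-1 : R).
Local Notation ts := (131 / 358 : R).
Local Notation ubar := (1 + 134 / 10 ^+ 4 + 87 / 10 ^+ 6 + 85 / 10 ^+ 8 : R).
Local Notation stot := (23 / 10 ^+ 5 + 65 / 10 ^+ 7 + 3 / 10 ^+ 8 : R).
Local Notation rho := (12 / 10 ^+ 8 : R).
Local Notation kk := (23 / 10 ^+ 5 + 67 / 10 ^+ 7 : R).
Local Notation eta := (10 ^- 8 : R).
Local Notation bst := (ts * (ubar + kk + 2 / 10 ^+ 8) : R).
Local Notation t1 := (ts - 18 / 10 ^+ 5 : R).
Local Notation w := (36 / 10 ^+ 5 : R).
Local Notation sig := (498 / 10 ^+ 6 : R).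

(** Before [ts] waiting counts as the better choice. With gains s1, s2 from lower levels, the
    condition on a bound a then reads (t a)' <= -(t s1 + (1 - t) s2), and const / t - kk satisfies
    it when [kk] majorizes the bracket. After [ts] every new top is sold to, and waiting is worth
    [stopval]. *)
Definition cont_bound t : R := if ts <= t then stopval t + eta
  else (bst + sig * Num.min (ts - t) w) / t - kk.

Lemma ts_gt0 : 0 < ts. Proof. lra. Qed.

Lemma disc_le1 t : t <= 1 -> disc t <= 1.
Proof. rewrite /disc; lra. Qed.

Lemma disc_inv_le t k : 0 <= t -> 1 <= k * disc t -> (disc t)^-1 <= k.
Proof. by move=> t0 H; rewrite -[leLHS]mul1r ler_pdivrMr // disc_gt0. Qed.

Lemma disc_inv_ge t k : 0 <= t -> k * disc t <= 1 -> k <= (disc t)^-1.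
Proof. by move=> t0 H; rewrite -[leRHS]mul1r ler_pdivlMr // disc_gt0. Qed.

Lemma cont_bound_lo t : 0 < t < ts -> bst / t - kk <= cont_bound t.
Proof.
move=> /andP[t0 tts]; rewrite /cont_bound; case: ifP => [|_]; first by lra.
rewrite lerD2r ler_wpM2r ?invr_ge0 ?(ltW t0) //.
rewrite lerDl; apply: mulr_ge0; first by lra.
by rewrite le_min; apply/andP; split; lra.
Qed.

Lemma cont_bound_early t : 0 < t <= t1 -> (disc t)^-1 <= cont_bound t.
Proof.
move=> /andP[t0 tt1]; apply: le_trans (cont_bound_lo _); last by apply/andP; split => //; lra.
apply: disc_inv_le; first exact: ltW.
have -> : (bst / t - kk) * disc t = (bst - kk * t) * disc t / t.
  by field; rewrite gt_eqF.
rewrite ler_pdivlMr // mul1r /disc.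
have : 0 <= t * (t1 - t) by rewrite mulr_ge0 ?(ltW t0) ?subr_ge0.
lra.
Qed.

Lemma cont_bound_window t : t1 <= t < ts -> (disc t)^-1 - sig <= cont_bound t.
Proof.
move=> /andP[tt1 tts]; have t0 : 0 < t by lra.
apply: le_trans (cont_bound_lo _); last by apply/andP; split => //; lra.
have : (disc t)^-1 <= 1 + 139 / 10 ^+ 4 + 85 / 10 ^+ 6.
  by apply: disc_inv_le; rewrite /disc; lra.
have : bst / ts <= bst / t.
  by apply: ler_wpM2l; [lra|rewrite lef_pV2 ?posrE; lra].
lra.
Qed.

Lemma cont_bound_ge t : 0 < t <= 1 -> (1 - t) / disc t <= cont_bound t.
Proof.
move=> /andP[t0 tle1]; have d1 := disc_le1 tle1; have d0 := disc_gt0 (ltW t0).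
have i1 : 1 <= (disc t)^-1 by apply: disc_inv_ge; lra.
have [tt|tt] := leP ts t.
  rewrite /cont_bound tt; have := @stopval_ge R t; rewrite t0 tle1 => /(_ isT); lra.
have p0 : 0 <= t * ((disc t)^-1 - 1) by apply: mulr_ge0; lra.
have [u|u] := leP t t1.
  have := @cont_bound_early t; rewrite t0 u => /(_ isT); lra.
have := @cont_bound_window t; rewrite tt (ltW u) => /(_ isT); lra.
Qed.

(** The reason for [+ eta] in [cont_bound]: at time 1, where [stopval] vanishes, a sale to a dummy
    may still be worth [eta]. *)
Lemma cont_bound_eta t : 0 < t <= 1 -> eta / disc t <= cont_bound t.
Proof.
move=> /andP[t0 tle1]; have d1 := disc_le1 tle1; have d0 := disc_gt0 (ltW t0).
have i1 : 1 <= (disc t)^-1 by apply: disc_inv_ge; lra.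
have [tt|tt] := leP ts t.
  have := @stopval_ge R t; rewrite /cont_bound tt t0 tle1 => /(_ isT).
  have : (disc t)^-1 = 1 + c * (1 - t) / disc t.
    by move: d0; rewrite /disc => d0; field; lra.
  have p0 : 0 <= (1 - t) * (disc t)^-1 by apply: mulr_ge0; lra.
  lra.
have [u|u] := leP t t1.
  have := @cont_bound_early t; rewrite t0 u => /(_ isT); lra.
have := @cont_bound_window t; rewrite tt (ltW u) => /(_ isT); lra.
Qed.

(** Up to 1/2, [stopval] loses at least 2 per unit of time, while the bound on [s] gains at most 1
    and [(disc t)^-1] loses at most 3/100; past 1/2, [stopval] has already dropped by more than 1/4.
    So after [ts] a record is worth selling to even when the lower levels are counted. *)
Lemma stopval_ub t s : ts <= t <= 1 -> 0 <= s -> (1 - t) * s <= stot ->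
  s <= 23 / 10 ^+ 3 -> stopval t + eta + s <= (disc t)^-1.
Proof.
move=> /andP[tst tle1] s0 sy sm; have ts0 := ts_gt0.
have t0 : 0 < t by exact: lt_le_trans tst.
have d0 := disc_gt0 (ltW t0); have d1 := disc_le1 tle1.
have i1 : 1 <= (disc t)^-1 by rewrite invf_ge1.
have V := stopval_sub_ge ts0 tst; have V0 := stopval_ts R.
have q0 : 0 <= (t - ts) / t by rewrite divr_ge0 ?subr_ge0 // ltW.
have {}V : (t - ts) / t <= stopval ts - stopval t.
  by apply: le_trans V; rewrite invfM mulrA ler_peMr.
have [u|u] := leP t (1 / 2).
  have q2 : 2 * (t - ts) <= (t - ts) / t.
    rewrite ler_pdivlMr //; have : 0 <= (t - ts) * (1 / 2 - t) by rewrite mulr_ge0 ?subr_ge0.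
    by clear; lra.
  have q3 : s <= stot * (358 / 227) + (t - ts).
    have y0 : 0 < 1 - t by move: u; clear; lra.
    have : s <= stot / (1 - t) by rewrite ler_pdivlMr // mulrC.
    move=> /le_trans; apply; rewrite ler_pdivrMr //.
    have : 0 <= (t - ts) * (1 / 2 - t) by rewrite mulr_ge0 ?subr_ge0.
    by move: tst; clear; lra.
  have q4 : 1 + 139 / 10 ^+ 4 + 76 / 10 ^+ 6 - 3 / 10 ^+ 2 * (t - ts) <= (disc t)^-1.
    apply: disc_inv_ge; first exact: ltW.
    have : 0 <= (t - ts) * (t - ts) by rewrite mulr_ge0 ?subr_ge0.
    by rewrite /disc; move: tst; clear; lra.
  by move: V V0 q2 q3 q4 tst; clear; lra.
have q2 : 268 / 10 ^+ 3 <= (t - ts) / t by rewrite ler_pdivlMr //; move: u; clear; lra.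
by move: V V0 q2 sm i1; clear; lra.
Qed.

(** The weights 1 and (1 - t') / t' of the two kinds of new top add up to 1 / t', which makes
    [b / t] the natural shape; [k] absorbs the gains [s1], [s2] from lower levels, and the drop
    [b - b'] pays for the excess [e] of the sale value [A] over waiting. *)
Lemma early_step_algebra t h A s1 s2 e k b b' : 0 < t -> 0 <= h -> t + h <= 1 ->
  0 <= s1 -> 0 <= s2 -> 0 <= e -> 0 <= b' -> A - (b' / (t + h) - k) <= e ->
  h * e <= b - b' -> (t + h) * s1 + (1 - (t + h)) * s2 <= k ->
  b' / (t + h) - k + h * (Num.max A (b' / (t + h) - k + s1) +
    (1 - (t + h)) / (t + h) * Num.max A (b' / (t + h) - k + s2)) <= b / t - k.
Proof.
move=> t0 h0; set t' := t + h => t'1 s10 s20 e0 b0; set x := b' / t' - k => Ax eb sk.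
have tt' : t <= t' by rewrite lerDl.
have t'0 : 0 < t' by exact: lt_le_trans tt'.
have m s : 0 <= s -> Num.max A (x + s) <= x + e + s.
  by move=> s0; rewrite ge_max; apply/andP; split; lra.
have q0 : 0 <= (1 - t') / t' by rewrite divr_ge0 ?subr_ge0 ?(ltW t'0).
have H := ler_wpM2l h0 (lerD (m _ s10) (ler_wpM2l q0 (m _ s20))).
apply: le_trans (lerD (lexx x) H) _.
have -> : x + h * (x + e + s1 + (1 - t') / t' * (x + e + s2)) =
  x + h / t' * (x + e + (t' * s1 + (1 - t') * s2)).
  by move: x {Ax m H}; move=> x; field; rewrite gt_eqF.
have ht : 0 <= h / t' by rewrite divr_ge0 // ltW.
apply: le_trans (lerD (lexx x) (ler_wpM2l ht (lerD (lexx (x + e)) sk))) _.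
have -> : x + h / t' * (x + e + k) = (b' / t') * (1 + h / t') + h * e / t' - k.
  by rewrite /x; field; rewrite gt_eqF.
rewrite lerD2r.
have r : 1 + h / t' <= t' / t.
  have -> : 1 + h / t' = (t' + h) / t' by field; rewrite gt_eqF.
  rewrite ler_pdivrMr // mulrAC ler_pdivlMr // /t'.
  have := mulr_ge0 h0 h0; clear; lra.
have -> : b / t = b' / t' * (t' / t) + (b - b') / t.
  by field; rewrite !gt_eqF.
have bt : 0 <= b' / t' by rewrite divr_ge0 // ltW.
apply: lerD; first by rewrite ler_wpM2l.
apply: (@le_trans _ _ ((b - b') / t')); first by rewrite ler_wpM2r // invr_ge0 ltW.
rewrite ler_wpM2l ?lef_pV2 ?posrE //; apply: le_trans eb; exact: mulr_ge0.
Qed.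

Lemma cont_bound_step_late t h s1 s2 : 0 < t -> 0 <= h <= 10 ^- 9 -> ts <= t + h <= 1 ->
  0 <= s1 <= s2 -> s2 <= 23 / 10 ^+ 3 -> (1 - (t + h)) * s2 <= stot ->
  cont_bound (t + h) + h * (Num.max (disc (t + h))^-1 (cont_bound (t + h) + s1) +
    (1 - (t + h)) / (t + h) * Num.max (disc (t + h))^-1 (cont_bound (t + h) + s2))
  <= cont_bound t.
Proof.
move=> t0 /andP[h0 h1]; set t' := t + h => /andP[u' t'1] /andP[s10 s12] s2m ys2.
have tlt' : t <= t' by rewrite lerDl.
have t'0 : 0 < t' by exact: lt_le_trans tlt'.
have d0 := disc_gt0 (ltW t'0).
have H2 : stopval t' + eta + s2 <= (disc t')^-1.
  by apply: stopval_ub => //; [rewrite u'|exact: le_trans s12].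
have hh : (t' - t) / (t' * disc t') = h / t' * (disc t')^-1.
  by rewrite /t' addrAC subrr add0r invfM mulrA.
have av : cont_bound t' = stopval t' + eta by rewrite /cont_bound u'.
have G1 := stopval_sub_ge t0 tlt'; rewrite hh in G1.
rewrite av !max_l //; last first.
  by apply: le_trans H2; rewrite lerD2l.
have -> : h * ((disc t')^-1 + (1 - t') / t' / disc t') = h / t' * (disc t')^-1.
  by move: d0 {H2 hh G1}; move: (disc t') => D d0; field; rewrite !gt_eqF.
have [u|u] := leP ts t.
  by rewrite /cont_bound u; move: G1; clear; set z := h / t' * _; lra.
have ts0 := ts_gt0.
have lo : bst / t - kk <= cont_bound t by apply: cont_bound_lo; rewrite t0.
apply: le_trans lo; clear hh av H2 ys2 s2m s10 s12 d0.
have t03 : 1 / 3 <= t by move: u' h1; rewrite /t'; clear; lra.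
(* The step crosses [ts], where the formula changes: the 2 / 10 ^+ 8 in [bst] covers [eta] and this
   increment of [stopval], tiny because [ts - t <= h]. *)
have Q : (ts - t) / (t * disc ts) <= 31 / 10 ^+ 10.
  have dt : 35 / 36 <= disc ts by clear; rewrite /disc; lra.
  rewrite ler_pdivrMr; last by apply: mulr_gt0 => //; clear -dt; lra.
  have : 0 <= (t - 1 / 3) * (disc ts - 35 / 36) by rewrite mulr_ge0 // subr_ge0.
  by move: u' h1 dt; rewrite /t'; clear; lra.
have G2 := stopval_sub_le t0 ts0.
have G3 := stopval_ts R.
have G4 : bst / ts <= bst / t.
  apply: ler_wpM2l; first by clear; lra.
  by rewrite lef_pV2 ?posrE // ltW.
move: G1 G2 G3 G4 Q; clear.
set z := h / t' * _; set q := (ts - t) / _; lra.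
Qed.

Lemma cont_bound_step_early t h s1 s2 : 0 < t -> 0 <= h <= 10 ^- 9 -> t + h < ts ->
  0 <= s1 <= s2 -> (1 - (t + h)) * s1 <= rho -> (1 - (t + h)) * s2 <= stot ->
  cont_bound (t + h) + h * (Num.max (disc (t + h))^-1 (cont_bound (t + h) + s1) +
    (1 - (t + h)) / (t + h) * Num.max (disc (t + h))^-1 (cont_bound (t + h) + s2))
  <= cont_bound t.
Proof.
move=> t0 /andP[h0 h1] u' /andP[s10 s12] ys1 ys2.
have tlt' : t <= t + h by rewrite lerDl.
have t'0 : 0 < t + h by exact: lt_le_trans tlt'.
have u : t < ts by exact: le_lt_trans u'.
pose B x := bst + sig * Num.min (ts - x) w.
have av x : x < ts -> cont_bound x = B x / x - kk by rewrite ltNge /cont_bound => /negbTE->.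
have B0 : 0 <= B (t + h).
  have m0 : 0 <= Num.min (ts - (t + h)) w.
    by rewrite le_min subr_ge0 (ltW u') /=; clear; lra.
  apply: addr_ge0; first by clear; lra.
  by apply: mulr_ge0 m0; clear; lra.
pose e := Num.max 0 ((disc (t + h))^-1 - cont_bound (t + h)).
have e0 : 0 <= e by rewrite le_max lexx.
have eA : (disc (t + h))^-1 - cont_bound (t + h) <= e by rewrite le_max lexx orbT.
rewrite [cont_bound t]av // (av _ u'); rewrite (av _ u') in eA.
apply: (early_step_algebra t0 h0 _ s10 (le_trans s10 s12) e0 B0 eA).
- by move: u'; clear; lra.
- have BB : B t - B (t + h) = sig * (Num.min (ts - t) w - Num.min (ts - (t + h)) w).
    by rewrite /B; ring.
  have sig0 : 0 <= sig by clear; lra.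
  rewrite BB; have [v|v] := leP (t + h) t1.
    have -> : e = 0.
      by apply/max_l; rewrite subr_le0; apply: cont_bound_early; rewrite t'0.
    rewrite mulr0; apply: (mulr_ge0 sig0); rewrite subr_ge0 le_min !ge_min.
    by rewrite lexx orbT andbT lerD2l lerN2 tlt'.
  have es : e <= sig.
    have W : (disc (t + h))^-1 - sig <= cont_bound (t + h).
      by apply: cont_bound_window; rewrite (ltW v).
    by rewrite ge_max sig0 /=; move: W; clear; lra.
  apply: (@le_trans _ _ (sig * h)); first by rewrite mulrC; apply: ler_wpM2r.
  apply: (ler_wpM2l sig0); rewrite !min_l; [clear; lra| |]; move: v h1; clear; lra.
have p1 : 0 <= (1 - (t + h)) * s1.
  by rewrite mulr_ge0 //; move: u'; clear; lra.
have p2 : 0 <= (ts - (t + h)) * s1.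
  by apply: mulr_ge0 s10; rewrite subr_ge0 ltW.
by move: ys1 ys2 p1 p2; clear; lra.
Qed.

Lemma cont_bound_step t h s1 s2 : 0 < t -> 0 <= h <= 10 ^- 9 -> t + h <= 1 ->
  0 <= s1 <= s2 -> s2 <= 23 / 10 ^+ 3 ->
  (1 - (t + h)) * s1 <= rho -> (1 - (t + h)) * s2 <= stot ->
  cont_bound (t + h) + h * (Num.max (disc (t + h))^-1 (cont_bound (t + h) + s1) +
    (1 - (t + h)) / (t + h) * Num.max (disc (t + h))^-1 (cont_bound (t + h) + s2))
  <= cont_bound t.
Proof.
move=> t0 hh t'1 s12 s2m ys1 ys2.
have [u|u] := leP ts (t + h); last exact: cont_bound_step_early.
by apply: cont_bound_step_late => //; rewrite u.
Qed.

(** The tail is dominated by a geometric series of ratio [x <= 1 / 2], whose sum is at most 2. *)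
Lemma expR_le_partial (x : R) n : 0 <= x <= 1 / 2 ->
  expR x <= \sum_(0 <= k < n) x ^+ k / k`!%:R + x ^+ n / n`!%:R * 2.
Proof.
move=> /andP[x0 x1]; rewrite /expR.
have T0 k : 0 <= x ^+ k / k`!%:R by rewrite divr_ge0 ?exprn_ge0 ?ler0n.
apply: limr_le; first exact: is_cvg_series_exp_coeff.
apply: nearW => m; rewrite /series /= -[m]/(m) /exp_coeff /=.
have [mn|nm] := leqP m n.
  rewrite -(subnKC mn) /index_iota !subn0 iotaD big_cat /= -addrA lerDl.
  by rewrite addr_ge0 ?sumr_ge0 // mulr_ge0.
rewrite (big_cat_nat _ (n := n)) ?(ltnW nm) //= lerD2l.
apply: (@le_trans _ _ (x ^+ n / n`!%:R * \sum_(n <= k < m) x ^+ (k - n))).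
  rewrite mulr_sumr [leLHS]big_nat [leRHS]big_nat ler_sum // => k /andP[nk km].
  rewrite mulrAC -exprD subnKC // ler_wpM2l ?exprn_ge0 //.
  by rewrite lef_pV2 ?posrE ?ltr0n ?fact_gt0 // ler_nat leq_fact.
apply: ler_wpM2l => //; apply: le_trans (sum_geo_le _ _ _) _; first by apply/andP; split; lra.
by rewrite -[leRHS]invrK lef_pV2 ?posrE; lra.
Qed.

Lemma expR_le_horner (x : R) : 0 <= x <= 1 / 2 ->
  expR x <= 1 + x / 1 * (1 + x / 2 * (1 + x / 3 * (1 + x / 4 * (1 + x / 5 * (1 + x / 6 *
    (1 + x / 7 * (1 + x / 8 * (1 + x / 9 * (1 + x / 10 * 2))))))))).
Proof.
move=> /(expR_le_partial 10)/le_trans; apply.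
have [F [F0 FS FE]] : exists F : nat -> R, [/\ F 0%N = 1,
    forall k, F k.+1 = k.+1%:R * F k & forall k, k`!%:R = F k].
  by exists (fun k => k`!%:R); split => // k; rewrite factS natrM.
under eq_bigr do rewrite FE.
rewrite FE !big_nat_recr //= big_nil !FS F0; lra.
Qed.

Lemma stopval_ts_ge : 1 + 134 / 10 ^+ 4 + 878 / 10 ^+ 7 <= stopval ts.
Proof.
rewrite /stopval ler_pdivlMr; last lra.
have t0 : 0 < ts by lra.
rewrite -ler_expR lnK ?posrE ?ratio_gt0 //.
set r := (_ + _) * _.
(* The exponent is close to 1; halving it meets the range of [expR_le_horner]. *)
have -> : r = 2%:R * (r / 2) by field.
rewrite expRM_natl.
have r0 : 0 <= r / 2 <= 1 / 2 by rewrite /r; apply/andP; split; lra.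
have H : expR (r / 2) <= 1 + 6416 / 10 ^+ 4 + 925 / 10 ^+ 7 + 16 / 10 ^+ 9.
  by apply: le_trans (expR_le_horner r0) _; rewrite /r; lra.
apply: le_trans (_ : (1 + 6416 / 10 ^+ 4 + 925 / 10 ^+ 7 + 16 / 10 ^+ 9) ^+ 2 <= _).
  by apply: lerXn2r; [rewrite nnegrE expR_ge0|rewrite nnegrE; lra|exact: H].
rewrite /disc; lra.
Qed.

(* [ratio_prim] integrates (1 - y) times a majorant of 1 / (1 - c y): its geometric
   series to order 3, with 507/500 absorbing the remainder. *)
Definition ratio_prim y : R := (y - y ^+ 2 / 2) + c * (y ^+ 2 / 2 - y ^+ 3 / 3) +
  c ^+ 2 * (y ^+ 3 / 3 - y ^+ 4 / 4) + 507 / 500 * c ^+ 3 * (y ^+ 4 / 4 - y ^+ 5 / 5).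

Lemma ratio_prim_step y h : 0 <= y -> 0 <= h -> y + h <= 227 / 358 ->
  h * ((1 - (y + h)) / disc (1 - y)) <= ratio_prim (y + h) - ratio_prim y + 2 * h ^+ 2.
Proof.
move=> y0 h0 yh.
pose p := 1 + c * y + c ^+ 2 * y ^+ 2 + 507 / 500 * c ^+ 3 * y ^+ 3.
have y3 : 0 <= y ^+ 3 by rewrite exprn_ge0.
have pA : (disc (1 - y))^-1 <= p.
  apply: disc_inv_le; first by lra.
  have -> : p * disc (1 - y) = 1 + c ^+ 3 * y ^+ 3 * (507 / 500 * (1 - c * y) - 1).
    by rewrite /p /disc; field.
  rewrite lerDl; apply: mulr_ge0; last by lra.
  by apply: mulr_ge0 y3; apply: exprn_ge0; lra.
have t0 : 0 <= 1 - (y + h) by lra.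
have := ler_wpM2l h0 (ler_wpM2l t0 pA); move/le_trans; apply.
have yle : y <= 1 by lra.
have hle : h <= 1 by lra.
have y1 i j : y ^+ i * h ^+ j <= 1.
  by rewrite mulr_ile1 ?exprn_ge0 ?exprn_ile1.
have y2 i j : 0 <= y ^+ i * h ^+ j by rewrite mulr_ge0 ?exprn_ge0.
have D : ratio_prim (y + h) - ratio_prim y + 2 * h ^+ 2 - h * ((1 - (y + h)) * p) = h ^+ 2 *
  (2 + 1 / 2 + c * (1 / 2 - h / 3) +
   c ^+ 2 * (y - y ^+ 2 / 2 + h / 3 - y * h - h ^+ 2 / 4) +
   507 / 500 * c ^+ 3 * (3 / 2 * y ^+ 2 - y ^+ 3 + y * h + h ^+ 2 / 4
      - 2 * (y ^+ 2 * h) - y * h ^+ 2 - h ^+ 3 / 5)).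
  by rewrite /ratio_prim /p; field.
rewrite -subr_ge0 D; apply: mulr_ge0; first exact: exprn_ge0.
have := (y1 2%N 0%N, y1 3%N 0%N, y1 1%N 1%N, y1 0%N 2%N, y1 2%N 1%N).
have := (y1 1%N 2%N, y1 0%N 3%N, y2 2%N 0%N, y2 3%N 0%N, y2 1%N 1%N).
have := (y2 0%N 2%N, y2 2%N 1%N, y2 1%N 2%N, y2 0%N 3%N).
rewrite !expr0 !expr1 !mulr1 !mul1r => -[[[e1 e2] e3] e4] -[[[[e5 e6] e7] e8] e9].
move=> -[[[[f1 f2] f3] f4] f5].
have g2 : - 2 <= y - y ^+ 2 / 2 + h / 3 - y * h - h ^+ 2 / 4 by lra.
have g3 : - 5 <= 3 / 2 * y ^+ 2 - y ^+ 3 + y * h + h ^+ 2 / 4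
      - 2 * (y ^+ 2 * h) - y * h ^+ 2 - h ^+ 3 / 5 by lra.
have F u v : - 2 <= u -> - 5 <= v ->
    0 <= 2 + 2^-1 + c * (2^-1 - h / 3) + c ^+ 2 * u + 507 / 500 * c ^+ 3 * v.
  by move=> u2 v5; clear -u2 v5 hle h0; lra.
exact: F.
Qed.

(* Majorizes the integral of [s * (stopval s + e)] over [s] from [t] to 1. *)
Definition stop_tail (e t : R) : R :=
  - (t ^+ 2 * stopval t / 2) + ratio_prim (1 - t) / 2 + e * ((1 - t ^+ 2) / 2).

(** Integration by parts: t * stopval t is the derivative of t^2 * stopval t / 2 plus t / (2 * disc
    t), and with y = 1 - t the last term is half of (1 - y) / (1 - c y), which [ratio_prim]
    integrates from above. The h^2 term absorbs the discretization. *)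
Lemma stop_tail_step e t h : 0 <= e <= 1 -> ts <= t -> 0 <= h -> t + h <= 1 ->
  h * (t * (stopval t + e)) <= stop_tail e t - stop_tail e (t + h) + 6 * h ^+ 2.
Proof.
move=> /andP[e0 e1] tst h0 th.
have t0 : 0 < t by lra.
have th0 : 0 < t + h by lra.
have d0 := disc_gt0 (ltW th0).
have i1 : (disc (t + h))^-1 <= 11 / 10 by apply: disc_inv_le; rewrite ?/disc; lra.
have i0 : 0 <= (disc (t + h))^-1 by rewrite invr_ge0 ltW.
set V := stopval t; set V' := stopval (t + h).
have V'0 : 0 <= V'.
  apply: le_trans (stopval_ge _); last by apply/andP; split.
  by rewrite divr_ge0 ?(ltW d0) // subr_ge0.
have VV' : V - V' <= h / t * (disc (t + h))^-1.
  by have := stopval_sub_le t0 th0; rewrite addrAC subrr add0r invfM mulrA.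
have V0 : 0 <= V.
  apply: le_trans (stopval_ge _); last by apply/andP; split; lra.
  by rewrite divr_ge0 ?(ltW (disc_gt0 (ltW t0))) // subr_ge0; lra.
have y0 : 0 <= 1 - (t + h) by lra.
have RS := @ratio_prim_step (1 - (t + h)) h y0 h0.
have E1 : 1 - (t + h) + h = 1 - t by ring.
have E2 : 1 - (1 - (t + h)) = t + h by ring.
have E3 : 1 - (1 - t) = t by ring.
rewrite E1 E2 E3 in RS.
have {}RS : h * (t / disc (t + h)) <=
  ratio_prim (1 - t) - ratio_prim (1 - (t + h)) + 2 * h ^+ 2.
  by apply: RS; lra.
rewrite /stop_tail -/V -/V'; set A := (disc (t + h))^-1 in i1 i0 VV' RS *.
have K : (t + h) ^+ 2 * (V - V') <= (t + h) ^+ 2 * (h / t * A).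
  by rewrite ler_wpM2l // exprn_ge0 // ltW.
have E4 : (t + h) ^+ 2 * (h / t * A) = t * h * A + 2 * (h ^+ 2 * A) + h ^+ 2 * A * (h / t).
  by field; lra.
have ht : h / t <= 2 by rewrite ler_pdivrMr //; lra.
have h2 : 0 <= h ^+ 2 by rewrite exprn_ge0.
have E5 : h ^+ 2 * A <= h ^+ 2 * (11 / 10) by rewrite ler_wpM2l.
have E6 : h ^+ 2 * A * (h / t) <= h ^+ 2 * A * 2 by rewrite ler_wpM2l // mulr_ge0.
have E7 : 0 <= V * h ^+ 2 by rewrite mulr_ge0.
have E8 : 0 <= e * h ^+ 2 by rewrite mulr_ge0.
clear -RS K E4 E5 E6 E7 E8 h2.
move: RS; set X := ratio_prim (1 - t); set Y := ratio_prim (1 - (t + h)) => RS.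
rewrite E4 in K; lra.
Qed.

Definition bmax : R := bst + sig * w.
Definition tail_slack : R := eta + stot.

(* Majorizes the integral of [t * (cont_bound t + stot)] over [t] from 0 to [x], with
   the discretization error for mesh [h]. *)
Definition area h x : R := bmax * Num.min x (ts + h) +
  (if ts <= x then stop_tail tail_slack ts - stop_tail tail_slack x else 0) + 6 * h * x.

Lemma bmax_ge0 : 0 <= bmax. Proof. rewrite /bmax; lra. Qed.

Lemma tail_slack01 : 0 <= tail_slack <= 1.
Proof. by rewrite /tail_slack; apply/andP; split; lra. Qed.

Lemma cont_bound_early_le t : 0 < t < ts -> t * (cont_bound t + stot) <= bmax.
Proof.
move=> /andP[t0 tts]; rewrite /cont_bound; case: ifP => [|_]; first lra.
have -> : t * ((bst + sig * Num.min (ts - t) w) / t - kk + stot) =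
  bst + sig * Num.min (ts - t) w - t * (kk - stot) by field; lra.
have q : Num.min (ts - t) w <= w by rewrite ge_min lexx orbT.
have : 0 <= t * (kk - stot) by apply: mulr_ge0; lra.
have : sig * Num.min (ts - t) w <= sig * w by apply: ler_wpM2l q; lra.
rewrite /bmax; lra.
Qed.

Lemma min_incr (x y z : R) : x <= y -> Num.min x z <= Num.min y z.
Proof. by move=> xy; rewrite le_min !ge_min xy lexx /= orbT. Qed.

Lemma area_step t h : 0 < t -> 0 < h -> t + h <= 1 ->
  h * (t * (cont_bound t + stot)) <= area h (t + h) - area h t.
Proof.
move=> t0 h0 th1; have b0 := bmax_ge0; have s0 := ts_gt0.
have hb : h * bmax = bmax * (t + h) - bmax * t by ring.
have h2 : 0 <= h * h by rewrite mulr_ge0 ?ltW.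
have [u|u] := leP ts t.
  have u' : ts <= t + h by apply: le_trans u _; rewrite lerDl ltW.
  have Z := stop_tail_step tail_slack01 u (ltW h0) th1.
  have M : bmax * Num.min t (ts + h) <= bmax * Num.min (t + h) (ts + h).
    by apply: ler_wpM2l => //; apply: min_incr; rewrite lerDl ltW.
  rewrite /area u u'; have -> : cont_bound t + stot = stopval t + tail_slack.
    by rewrite /cont_bound u /tail_slack; exact: esym (addrA _ _ _).
  by move: Z M; rewrite expr2; clear; lra.
have AE : h * (t * (cont_bound t + stot)) <= h * bmax.
  by rewrite ler_wpM2l ?(ltW h0) // cont_bound_early_le // t0.
have m1 : Num.min t (ts + h) = t by apply: min_l; rewrite ltW // ltr_wpDr // ltW.
have m2 : Num.min (t + h) (ts + h) = t + h by apply: min_l; rewrite lerD2r ltW.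
rewrite /area m1 m2 [ts <= t]leNgt u /=; case: ifP => u'; last first.
  by move: AE hb h2; clear; lra.
(* The step straddles [ts]. It is charged in full to [bmax], which is why [area] cuts at [ts + h];
   the tail part added on top only has to be at least -6 h^2. *)
have h'0 : 0 <= t + h - ts by rewrite subr_ge0.
have E : ts + (t + h - ts) = t + h by rewrite addrC subrK.
have := stop_tail_step tail_slack01 (lexx ts) h'0; rewrite E => /(_ th1).
have V0 : 0 <= stopval ts by apply: le_trans (stopval_ts_ge); lra.
have e0 : 0 <= tail_slack by case/andP: tail_slack01.
have p0 : 0 <= (t + h - ts) * (ts * (stopval ts + tail_slack)).
  apply: (mulr_ge0 h'0); apply: mulr_ge0; first exact: ltW.
  exact: addr_ge0.
have p1 : (t + h - ts) ^+ 2 <= h ^+ 2.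
  by apply: lerXn2r; rewrite ?nnegrE ?(ltW h0) //; move: u; clear; lra.
move: AE hb h2 p0 p1; rewrite [h ^+ 2]expr2; clear.
set Z1 := stop_tail tail_slack ts; set Z2 := stop_tail tail_slack (t + h).
set P := (t + h - ts) * _.
set Q := h * (t * _); set S := (t + h - ts) ^+ 2.
lra.
Qed.

Lemma stop_tail1 : stop_tail tail_slack 1 = 0.
Proof. by rewrite /stop_tail stopval1 /ratio_prim subrr; field. Qed.

Lemma area1 h : 0 < h <= 10 ^- 10 -> area h 1 + h <= 285 / 10 ^+ 3 + 784 / 10 ^+ 6.
Proof.
move=> /andP[h0 h1]; rewrite /area stop_tail1; case: ifP => [_|]; last lra.
have m : bmax * Num.min 1 (ts + h) <= bmax * (ts + h).
  by apply: (ler_wpM2l bmax_ge0); rewrite ge_min lexx orbT.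
have V := stopval_ts_ge.
have bh : bmax * h <= h by rewrite ler_piMl ?(ltW h0) // /bmax; lra.
have Rb : ratio_prim (1 - ts) <= 435 / 10 ^+ 3 + 59 / 10 ^+ 5 + 48 / 10 ^+ 7.
  have -> : 1 - ts = 227 / 358 by field.
  rewrite /ratio_prim; lra.
rewrite mulrDr in m.
rewrite /stop_tail; move: Rb V h1 bh m; rewrite /bmax /tail_slack.
set r := ratio_prim _; set V := stopval _; clear -h0; lra.
Qed.

End Potential.

(** * Bounding the game numerically *)

Section Bound.
Variable R : realType.
Local Notation c := (46^-1 : R).
Local Notation ts := (131 / 358 : R).
Local Notation stot := (23 / 10 ^+ 5 + 65 / 10 ^+ 7 + 3 / 10 ^+ 8 : R).
Local Notation rho := (12 / 10 ^+ 8 : R).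
Local Notation eta := (10 ^- 8 : R).

Lemma area0 (h : R) : 0 < h <= 10 ^- 10 -> 0 <= area h h.
Proof.
move=> /andP[h0 h1]; rewrite /area [ts <= h]leNgt.
have -> /= : h < ts by lra.
have M0 : 0 <= Num.min h (ts + h) by rewrite le_min; apply/andP; split; lra.
have := mulr_ge0 (bmax_ge0 R) M0; have := mulr_ge0 (ltW h0) (ltW h0).
set m := bmax R * _; clear; lra.
Qed.

Lemma sum_area (N : nat) (h := N%:R^-1 : R) : (0 < N)%N -> h <= 10 ^- 10 ->
  h * \sum_(1 <= i < N.+1) (i%:R * h) * (cont_bound (i%:R * h) + stot) <=
  285 / 10 ^+ 3 + 784 / 10 ^+ 6.
Proof.
move=> N0 h1; have h0 : 0 < h by rewrite invr_gt0 ltr0n.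
have Nh : N%:R * h = 1 by rewrite mulfV // pnatr_eq0 -lt0n.
have claim n : (n < N)%N ->
  h * \sum_(1 <= i < n.+1) (i%:R * h) * (cont_bound (i%:R * h) + stot) <= area h (n.+1%:R * h).
  elim: n => [_|n IH nN].
    by rewrite big_geq // mulr0 mul1r area0 // h0.
  rewrite big_nat_recr //= mulrDr.
  have nh : n.+2%:R * h = n.+1%:R * h + h by rewrite -natr1 mulrDl mul1r.
  have nh0 : 0 < n.+1%:R * h by rewrite mulr_gt0 // ltr0n.
  have nh1 : n.+1%:R * h + h <= 1.
    have : n.+2%:R * h <= N%:R * h by rewrite ler_wpM2r ?(ltW h0) // ler_nat.
    by rewrite nh Nh.
  have := area_step nh0 h0 nh1; rewrite -nh; have := IH (ltnW nN).
  set a := h * \sum_(_ <= _ < _) _; set b := h * _; clear; lra.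
(* The point t = 1 has no interval to its right; it is charged to the summand [+ h] of [area1]. *)
rewrite big_nat_recr //= mulrDr Nh mul1r.
have a1 : cont_bound 1 + stot <= 1 :> R.
  rewrite /cont_bound; case: ifP => [_|]; [rewrite stopval1; lra|lra].
have hA : h * (cont_bound 1 + stot) <= h by rewrite ler_piMr // ltW.
have A1 : area h 1 + h <= 285 / 10 ^+ 3 + 784 / 10 ^+ 6 by apply: area1; rewrite h0.
have N1 : (N.-1 < N)%N by rewrite prednK.
have := claim _ N1; rewrite prednK // Nh.
move: hA A1; set u := h * (_ + _); set v := h * \sum_(_ <= _ < _) _; clear; lra.
Qed.

Lemma cont_bound_le t : 0 < t <= 1 -> cont_bound t <= 2 / t :> R.
Proof.
move=> /andP[t0 t1]; rewrite ler_pdivlMr // mulrC.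
have [u|u] := leP ts t.
  have ts0 := ts_gt0 R.
  have V := stopval_sub_ge ts0 u; have Vt := stopval_ts R.
  have : 0 <= (t - ts) / (t * disc t).
    apply: divr_ge0; first by rewrite subr_ge0.
    by apply: mulr_ge0; [exact: ltW|exact/ltW/disc_gt0/ltW].
  have av : cont_bound t = stopval t + eta by rewrite /cont_bound u.
  have : 0 <= cont_bound t.
    apply: le_trans (cont_bound_ge _); last by rewrite t0.
    by apply: divr_ge0; [rewrite subr_ge0|exact/ltW/disc_gt0/ltW].
  rewrite av => p q.
  have : t * (stopval t + eta) <= stopval t + eta by rewrite ler_piMl.
  lra.
have := @cont_bound_early_le R t; rewrite t0 u => /(_ isT).
have : 0 <= t * stot by apply: mulr_ge0; lra.
rewrite mulrDr /bmax; lra.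
Qed.

(** The integral is cut at [e]: before it the cap [x] is used, after it [cont_bound t <= 2 / t]. *)
Lemma sum_cap (N : nat) (x e : R) (h := N%:R^-1 : R) : (0 < N)%N -> 0 <= x -> 0 < e ->
  h * \sum_(1 <= i < N.+1) Num.min x (cont_bound (i%:R * h)) <= x * e + 2 / e.
Proof.
move=> N0 x0 e0; have h0 : 0 < h by rewrite invr_gt0 ltr0n.
have Nh : N%:R * h = 1 by rewrite mulfV // pnatr_eq0 -lt0n.
have claim n : (n <= N)%N ->
  h * \sum_(1 <= i < n.+1) Num.min x (cont_bound (i%:R * h)) <=
  x * Num.min (n%:R * h) e + 2 / e * (n%:R * h).
  elim: n => [_|n IH nN].
    rewrite big_geq // mulr0 mul0r mulr0 addr0 mulr_ge0 // le_min lexx; exact: ltW.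
  rewrite big_nat_recr //= mulrDr.
  have nh : n.+1%:R * h = n%:R * h + h by rewrite -natr1 mulrDl mul1r.
  have nh0 : 0 < n.+1%:R * h by rewrite mulr_gt0 // ltr0n.
  have nh1 : n.+1%:R * h <= 1.
    have : n.+1%:R * h <= N%:R * h by rewrite ler_wpM2r ?(ltW h0) // ler_nat.
    by rewrite Nh.
  have q0 : 0 <= 2 / e * h by rewrite !mulr_ge0 ?invr_ge0 ?(ltW e0) ?(ltW h0).
  apply: (@le_trans _ _ (x * Num.min (n%:R * h) e + 2 / e * (n%:R * h) +
     h * Num.min x (cont_bound (n.+1%:R * h)))).
    by rewrite lerD2r IH // ltnW.
  have [u|u] := leP (n.+1%:R * h) e.
    have u' : n%:R * h <= e by apply: le_trans u; rewrite nh lerDl ltW.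
    rewrite (min_l u') nh !mulrDr.
    have : h * Num.min x (cont_bound (n%:R * h + h)) <= h * x.
      by rewrite ler_wpM2l ?(ltW h0) // ge_min lexx.
    move: q0; clear; lra.
  have M : x * Num.min (n%:R * h) e <= x * e by rewrite ler_wpM2l // ge_min lexx orbT.
  have : h * Num.min x (cont_bound (n.+1%:R * h)) <= h * (2 / e).
    rewrite ler_wpM2l ?(ltW h0) // ge_min; apply/orP; right.
    apply: le_trans (cont_bound_le _) _; first by rewrite nh0.
    by rewrite ler_wpM2l // lef_pV2 ?posrE // ltW.
  move: M; rewrite nh mulrDr; clear; lra.
apply: le_trans (claim N (leqnn N)) _; rewrite Nh mulr1 lerD2r.
by rewrite ler_wpM2l // ge_min lexx orbT.
Qed.

Variable N : nat.
Hypothesis N0 : (0 < N)%N.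
Local Notation h := (N%:R^-1 : R).
Local Notation y := (@tfrac R N).
Local Notation C := ((1 - c ^+ 2)^-1 : R).

(* Selling to the agent [j] levels below the top beats waiting only while the
   remaining fraction [l / N] is below [c ^+ j <= c]; then [1 - c * y m >= 1 - c ^+ 2]. *)
Definition kap (j m : nat) : R :=
  C * (h * \sum_(0 <= l < m) Num.max 0 (c ^+ j - l%:R * h)).

Lemma h_gt0 : 0 < h. Proof. by rewrite invr_gt0 ltr0n. Qed.

Lemma C_gt0 : 0 < C. Proof. rewrite invr_gt0; lra. Qed.

Lemma kap_ge0 j m : 0 <= kap j m.
Proof.
by rewrite mulr_ge0 ?(ltW C_gt0) // mulr_ge0 ?(ltW h_gt0) // sumr_ge0.
Qed.

Lemma kap_step j m (x : R) : (0 < j)%N -> (m < N)%N -> y m / (1 - c * y m) <= x ->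
  kap j m + h * Num.max 0 (c ^+ j / (1 - c * y m) - x) <= kap j m.+1.
Proof.
move=> j0 mN yx; rewrite /kap big_nat_recr //= !mulrDr lerD2l.
rewrite [leRHS]mulrCA ler_wpM2l ?(ltW h_gt0) // -[m%:R * h]/(y m).
have y0 := tfrac_ge0 R N m; have y1 := tfrac_lt1 R mN.
have d0 : 0 < 1 - c * y m by lra.
rewrite ge_max; apply/andP; split.
  by rewrite mulr_ge0 ?(ltW C_gt0) // le_max lexx.
have cj : c ^+ j <= c by rewrite -{2}[c]expr1 ler_wiXn2l //; lra.
have e : c ^+ j / (1 - c * y m) - x <= (c ^+ j - y m) / (1 - c * y m).
  by rewrite mulrBl lerD2l lerN2.
apply: le_trans e _; have [u|u] := leP (y m) (c ^+ j).
  rewrite max_r ?subr_ge0 // mulrC ler_wpM2r ?subr_ge0 //.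
  by rewrite lef_pV2 ?posrE //; lra.
rewrite max_l; last by rewrite subr_le0 ltW.
by rewrite mulr0 pmulr_lle0 ?invr_gt0 // subr_le0 ltW.
Qed.

Lemma kap_le_lin j m : kap j m <= y m * (C * c ^+ j).
Proof.
have -> : y m * (C * c ^+ j) = C * (h * (m%:R * c ^+ j)) by rewrite /tfrac; ring.
rewrite ler_wpM2l ?(ltW C_gt0) // ler_wpM2l ?(ltW h_gt0) //.
have -> : m%:R * c ^+ j = \sum_(0 <= l < m) c ^+ j.
  by rewrite sumr_const_nat subn0 mulr_natl.
apply: ler_sum => l _; rewrite ge_max exprn_ge0 /= ?gerBl ?mulr_ge0 ?(ltW h_gt0) //.
Qed.

(** A Riemann sum of max(0, a - x), whose integral is a^2 / 2. Shifting by one mesh gives a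
    quadratic [q] that drops by at least each summand, so the sum telescopes. *)
Lemma kap_le_const j m : kap j m <= C * ((c ^+ j + h) ^+ 2 / 2).
Proof.
rewrite ler_wpM2l ?(ltW C_gt0) //; set a := c ^+ j.
have a0 : 0 <= a by rewrite exprn_ge0.
pose q x : R := Num.max 0 (a + h - x) ^+ 2 / 2.
have q0 x : 0 <= q x by rewrite divr_ge0 // exprn_ge0 // le_max lexx.
suff claim : h * \sum_(0 <= l < m) Num.max 0 (a - l%:R * h) <= q 0 - q (m%:R * h).
  apply: le_trans claim _; rewrite lerBlDr /q subr0 max_r ?addr_ge0 ?(ltW h_gt0) //.
  by rewrite lerDl; exact: q0.
elim: m => [|m IH]; first by rewrite big_geq // mulr0 mul0r subrr.
rewrite big_nat_recr //= mulrDr; apply: le_trans (lerD IH (lexx _)) _.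
have H := h_gt0.
rewrite /q; have -> : a + h - m.+1%:R * h = a - m%:R * h by rewrite -natr1; ring.
set z := a - m%:R * h; have -> : a + h - m%:R * h = z + h by rewrite /z; ring.
have [u|u] := leP 0 z.
  have zh : 0 <= z + h by rewrite addr_ge0 // ltW.
  rewrite (max_r zh).
  have := mulr_ge0 (ltW H) (ltW H); clear; lra.
rewrite mulr0 addr0 lerD2l lerN2 ler_wpM2r ?invr_ge0 //.
by rewrite expr0n /= exprn_ge0 // le_max lexx.
Qed.

Lemma c_sum_le (k : nat) (q : R) (n : nat) : 0 <= q <= c ->
  \sum_(k <= j < n) q ^+ j <= q ^+ k / (1 - q).
Proof.
move=> /andP[q0 q1].
have -> : \sum_(k <= j < n) q ^+ j = q ^+ k * \sum_(k <= j < n) q ^+ (j - k).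
  by rewrite mulr_sumr; apply: eq_big_nat => j /andP[kj _]; rewrite -exprD subnKC.
by rewrite ler_wpM2l ?exprn_ge0 // sum_geo_le //; apply/andP; split => //; lra.
Qed.

Variable L : nat.
Hypothesis L0 : (0 < L)%N.
Hypothesis LN : L%:R * h <= 10 ^- 10.

Lemma h_small : h <= 10 ^- 10.
Proof.
apply: le_trans LN; rewrite ler_peMl ?(ltW h_gt0) //.
by rewrite ler1n.
Qed.

Lemma kap_sum (k m : nat) : (0 < k)%N ->
  \sum_(k <= j < L.+1) kap j m <=
  C * ((c ^+ 2) ^+ k / (1 - c ^+ 2) / 2) + 3 * 10 ^- 10.
Proof.
move=> k0; have H := h_gt0; have h1 := h_small.
apply: (@le_trans _ _ (\sum_(k <= j < L.+1) (C / 2 * (c ^+ 2) ^+ j + 3 * h))).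
  apply: ler_sum => j _; apply: le_trans (kap_le_const j m) _.
  have C2 : C <= 2 by rewrite -[leRHS]invrK lef_pV2 ?posrE; lra.
  have cj : c ^+ j <= 1 by rewrite exprn_ile1 //; lra.
  have -> : C * ((c ^+ j + h) ^+ 2 / 2) = C / 2 * (c ^+ 2) ^+ j + C * (h * (c ^+ j + h / 2)).
    have -> : (c ^+ 2) ^+ j = (c ^+ j) ^+ 2 by rewrite -!exprM mulnC.
    by move: C (c ^+ j) h => K a x; field.
  rewrite lerD2l.
  have cj0 : 0 <= c ^+ j by rewrite exprn_ge0.
  have E0 : 0 <= h * (c ^+ j + h / 2) by apply: mulr_ge0; lra.
  have E1 : h * (c ^+ j + h / 2) <= h * (3 / 2) by apply: ler_wpM2l; lra.
  have := ler_wpM2r E0 C2; move: E1; lra.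
rewrite big_split /= -mulr_sumr sumr_const_nat.
have c2 : 0 <= c ^+ 2 <= c by apply/andP; split; lra.
have := ler_wpM2l (ltW (divr_gt0 C_gt0 (ltr0Sn R 1))) (c_sum_le k L.+1 c2).
have : (3 * h) *+ (L.+1 - k) <= 3 * 10 ^- 10.
  rewrite -mulr_natr -mulrA; apply: ler_wpM2l; first by [].
  apply: le_trans LN; rewrite mulrC ler_wpM2r ?(ltW H) // ler_nat.
  by rewrite leq_subLR; lia.
lra.
Qed.

Lemma C_val : C = 2116 / 2115.
Proof. by field. Qed.

Lemma kap_sum1 m : \sum_(1 <= j < L.+1) kap j m <= stot.
Proof. apply: le_trans (kap_sum m (ltn0Sn 0)) _; rewrite C_val; lra. Qed.

Lemma kap_sum2 m : \sum_(2 <= j < L.+1) kap j m <= rho.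
Proof. apply: le_trans (kap_sum m (ltn0Sn 1)) _; rewrite C_val; lra. Qed.

Definition slot_bound m : R := cont_bound (1 - y m).
Definition kth j m : R := kap j m / y m.
Definition top1 m : R :=
  Num.max (1 - c * y m)^-1 (slot_bound m + \sum_(2 <= j < L.+1) kth j m).
Definition top2 m : R :=
  Num.max (1 - c * y m)^-1 (slot_bound m + \sum_(1 <= j < L.+1) kth j m).

Lemma disc_rev x : disc (1 - x) = 1 - c * x :> R.
Proof. by rewrite /disc; ring. Qed.

Lemma time_bounds m : (m < N)%N -> 0 < 1 - y m <= 1.
Proof.
move=> mN; have y0 := tfrac_ge0 R N m; have y1 := tfrac_lt1 R mN.
by apply/andP; split; lra.
Qed.

Lemma kth_ge0 j m : 0 <= kth j m.
Proof. by rewrite divr_ge0 ?kap_ge0 ?tfrac_ge0. Qed.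

Lemma kap_kth j m : kap j m <= y m * kth j m.
Proof.
have [E|yn] := eqVneq (y m) 0; last by rewrite /kth mulrC divfK.
by have := kap_le_lin j m; rewrite /kth E !mul0r.
Qed.

Lemma kth_le j m : kth j m <= C * c ^+ j.
Proof.
have [E|yn] := eqVneq (y m) 0.
  by rewrite /kth E invr0 mulr0 mulr_ge0 ?(ltW C_gt0) ?exprn_ge0.
by rewrite ler_pdivrMr ?lt0r ?yn ?tfrac_ge0 // mulrC kap_le_lin.
Qed.

Lemma kth_sum k m : y m * \sum_(k <= j < L.+1) kth j m <= \sum_(k <= j < L.+1) kap j m.
Proof.
rewrite mulr_sumr ler_sum // => j _.
have [E|yn] := eqVneq (y m) 0; first by rewrite E mul0r kap_ge0.
by rewrite /kth mulrC divfK.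
Qed.

(** Complements [kth_sum], which yields only [stot / y], useless near the end where [y] tends to
    0. *)
Lemma kth_sum_le m : \sum_(1 <= j < L.+1) kth j m <= 23 / 10 ^+ 3.
Proof.
apply: (@le_trans _ _ (C * \sum_(1 <= j < L.+1) c ^+ j)).
  by rewrite mulr_sumr ler_sum // => j _; exact: kth_le.
have cc : 0 <= c <= c by apply/andP; split; lra.
have := ler_wpM2l (ltW C_gt0) (c_sum_le 1 L.+1 cc); rewrite C_val expr1.
have -> : c / (1 - c) = 1 / 45 by field.
lra.
Qed.

Lemma slot_bound_step m : (m.+1 < N)%N ->
  slot_bound m + h * (top1 m + y m / (1 - y m) * top2 m) <= slot_bound m.+1.
Proof.
move=> mN; have /andP[t0 t1] := time_bounds mN.
have /andP[_ t'1] := time_bounds (ltnW mN).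
have E : 1 - y m.+1 + h = 1 - y m by rewrite tfracS; ring.
pose s1 := \sum_(2 <= j < L.+1) kth j m; pose s2 := \sum_(1 <= j < L.+1) kth j m.
have s10 : 0 <= s1 by apply: sumr_ge0 => j _; exact: kth_ge0.
have s12 : s1 <= s2 by rewrite /s2 big_ltn // lerDr kth_ge0.
have hh : 0 <= h <= 10 ^- 9.
  by apply/andP; split; [exact: ltW h_gt0|apply: le_trans h_small _; lra].
have yE : 1 - (1 - y m) = y m by ring.
have := @cont_bound_step R (1 - y m.+1) h s1 s2 t0 hh; rewrite E yE disc_rev.
apply => //; first by apply/andP.
- exact: kth_sum_le.
- exact: le_trans (kth_sum 2 m) (kap_sum2 m).
- exact: le_trans (kth_sum 1 m) (kap_sum1 m).
Qed.

Section Strategy.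
Variables (T : Type) (D : seq T -> bool).
Variables (rs : T) (rb rd : nat -> T) (v : nat -> R).
Hypothesis v_le : forall i, 0 <= v i <= eta.

Lemma sum_holding_gain_slot_bound m e U hist : (m < N)%N -> (e <= L)%N -> uniq U ->
  all (fun j => (0 < j < e)%N) U ->
  \sum_(e <= K < L.+1) holding_gain D rb rd v c N K m (U ++ iota e.+1 (K - e)) hist <=
  Psi (slot_bound m) (fun j => kap (e - j) m) (y m) U.
Proof.
apply: (@sum_holding_gain_le R T D rb rd v c N L eta slot_bound kap kth top1 top2).
- by apply/andP; split; lra.
- exact: v_le.
- by move=> i iN; rewrite -disc_rev; apply: cont_bound_eta; exact: time_bounds.
- exact: kap_ge0.
- exact: kth_ge0.
- by move=> j i _; exact: kap_kth.
- move=> j i /andP[j0 _] iN; apply: kap_step => //; first exact: ltnW.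
  have := cont_bound_ge (time_bounds (ltnW iN)); rewrite disc_rev.
  by have -> : 1 - (1 - y i) = y i by ring.
- by move=> i _; rewrite le_max lexx.
- by move=> i _; rewrite le_max lexx.
- by move=> i _; rewrite le_max lexx orbT.
- by move=> i _; rewrite le_max lexx orbT.
- exact: slot_bound_step.
Qed.

(* [cont_bound t] blows up like 1 / t at 0; before any real buyer is seen, the
   trivial bound [L.+1] replaces it. *)
Definition alpha (e m : nat) : R :=
  if e == 0%N then Num.min L.+1%:R (slot_bound m) else slot_bound m.

Lemma slot_bound_ge0 m : (m < N)%N -> 0 <= slot_bound m.
Proof.
move=> mN; have /andP[t0 t1] := time_bounds mN.
apply: le_trans (cont_bound_ge (time_bounds mN)).
by apply: divr_ge0; [rewrite subr_ge0|exact/ltW/disc_gt0/ltW].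
Qed.

Lemma alpha_ge0 e m : (m < N)%N -> 0 <= alpha e m.
Proof.
by move=> mN; rewrite /alpha; case: ifP => _; rewrite ?le_min ?ler0n slot_bound_ge0.
Qed.

Lemma sum_holding_gain_alpha m e U hist : (m < N)%N -> (e <= L)%N -> uniq U ->
  all (fun j => (0 < j < e)%N) U ->
  \sum_(e <= K < L.+1) holding_gain D rb rd v c N K m (U ++ iota e.+1 (K - e)) hist <=
  Psi (alpha e m) (fun j => kap (e - j) m) (y m) U.
Proof.
move=> mN eL uU aU; have B := sum_holding_gain_slot_bound hist mN eL uU aU.
rewrite /alpha; case: eqP => [e0|_] //; subst e.
case: U uU aU B => [|j U] uU aU B; last by move: aU => /= /andP[/andP[_]]; rewrite ltn0.
move: B; rewrite /Psi big_nil !mulr0 !addr0 expr0 !mul1r le_min => ->.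
rewrite andbT; apply: (@le_trans _ _ (\sum_(0 <= K < L.+1) 1)); last first.
  by rewrite sumr_const_nat subn0.
apply: ler_sum => K _.
apply: (@le_trans _ _ (y m ^+ size (iota 1 (K - 0)))); last first.
  by rewrite exprn_ile1 ?tfrac_ge0 // ltW // tfrac_lt1.
apply: holding_gain_le_tfrac; [by apply/andP; split; lra| |exact: iota_uniq].
by move=> i; have /andP[-> vi] := v_le i; apply: le_trans vi _; lra.
Qed.

Lemma seller_val_le m0 : (m0 < N)%N ->
  seller_val N L alpha kap m0 N 0 [::] <=
  Num.min L.+1%:R (cont_bound (1 - y m0)) +
  L%:R * ((1 - y m0) * (cont_bound (1 - y m0) + stot)).
Proof.
move=> mN; have yN : y N = 1 by rewrite /tfrac mulfV // pnatr_eq0 -lt0n.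
have /andP[t0 t1] := time_bounds mN.
(* Either no real buyer precedes the seller and the capped bound applies, or the top [x] at that
   moment came earlier, with weight [1 - y m0]; this factor tames the 1 / t growth of
   [cont_bound]. *)
rewrite /seller_val yN; apply: lerD.
  by rewrite /future_top /Psi big_nil mulr0 addr0 expr0 mul1r /alpha.
apply: (@le_trans _ _ (\sum_(1 <= x < L.+1)
   ((1 - y m0) * (cont_bound (1 - y m0) + stot)))); last first.
  by rewrite sumr_const_nat subSS subn0 [leRHS]mulr_natl.
rewrite big_nat [leRHS]big_nat ler_sum // => x /andP[x1 xL].
apply: ler_wpM2l; first exact: ltW.
rewrite /future_top /Psi !expr1n !mul1r /alpha; case: eqP x1 => [->|_] // x1.
rewrite lerD2l; apply: le_trans (kap_sum1 m0).
apply: (@sum_levels R L (fun j => kap j m0)) => //.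
- by move=> j; exact: kap_ge0.
- exact: iota_uniq.
- by apply/allP => j /=; rewrite mem_iota; lia.
- by apply/allP => j /=; rewrite mem_iota; lia.
Qed.

Lemma game_bound (e : R) hist : 0 < e ->
  \sum_(0 <= K < L.+1) waiting_gain D rs rb rd v c N K N (iota 1 K) hist <=
  L.+1%:R * e + 2 / e + L%:R * (285 / 10 ^+ 3 + 784 / 10 ^+ 6).
Proof.
move=> e0.
have := sum_waiting_gain_le rs alpha_ge0 kap_ge0 sum_holding_gain_alpha hist
  (leqnn N) (leq0n L) (isT : uniq [::])
  (isT : all (fun j => (0 < j < 0)%N) [::]).
under eq_bigr do rewrite subn0 /=.
move=> /le_trans; apply.
apply: (@le_trans _ _ (h * \sum_(0 <= m0 < N) (Num.min L.+1%:R (cont_bound (1 - y m0)) +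
   L%:R * ((1 - y m0) * (cont_bound (1 - y m0) + stot))))).
  rewrite ler_wpM2l ?(ltW h_gt0) // big_nat [leRHS]big_nat ler_sum // => m0 /andP[_ mN].
  exact: seller_val_le.
pose F (t : R) := Num.min L.+1%:R (cont_bound t) + L%:R * (t * (cont_bound t + stot)).
have -> : \sum_(0 <= m0 < N) (Num.min L.+1%:R (cont_bound (1 - y m0)) +
   L%:R * ((1 - y m0) * (cont_bound (1 - y m0) + stot))) = \sum_(1 <= i < N.+1) F (i%:R * h).
  rewrite big_add1 /= big_nat_rev /= add0n; apply: eq_big_nat => i /andP[_ iN].
  have -> : 1 - y (N - i.+1) = i.+1%:R * h; last by [].
  rewrite /tfrac natrB // mulrBl mulfV ?pnatr_eq0 -?lt0n //; ring.
rewrite /F big_split /= mulrDr -mulr_sumr; apply: lerD; first exact: sum_cap.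
rewrite mulrCA ler_wpM2l // sum_area //; exact: h_small.
Qed.

End Strategy.
End Bound.

(** * The weak offline optimum *)

Section Last.
Variable n : nat.
Local Notation N := n.+1.

Definition last_in (S : {set 'I_N}) (x : 'I_N) (s : 'S_N) :=
  [forall y in S, ((s^-1)%g y <= (s^-1)%g x)%N].

Lemma last_in_unique (S : {set 'I_N}) (s : 'S_N) : S != finset.set0 ->
  (\sum_(x in S) last_in S x s = 1)%N.
Proof.
move=> /finset.set0Pn[x0 x0S].
case: (@arg_maxnP _ x0 (mem S) (fun x => (s^-1)%g x : nat) x0S) => x xS xmax.
rewrite (bigD1 x) //= big1 ?addn0.
  have -> // : last_in S x s by apply/forall_inP => y yS; exact: xmax.
move=> y /andP[yS yx]; apply/eqP; rewrite eqb0; apply: contra yx => /forall_inP ymax.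
rewrite -(inj_eq (@perm_inj _ (s^-1)%g)) -val_eqE eqn_leq.
by rewrite [X in X && _]xmax //= ymax.
Qed.

(** Exchanging the agents [x] and [y] in every order maps one set onto the other. *)
Lemma card_last_in_eq (S : {set 'I_N}) (x y : 'I_N) : x \in S -> y \in S ->
  #|[set s | last_in S x s]| = #|[set s | last_in S y s]|.
Proof.
move=> xS yS; pose f (s : 'S_N) := (s * tperm x y)%g.
have fI : injective f by exact: mulIg.
rewrite -(card_imset _ fI); congr #|pred_of_set _|; apply/setP => s.
have E (u : 'S_N) z : ((f u)^-1)%g z = (u^-1)%g (tperm x y z).
  by rewrite /f invMg permM tpermV.
have tS z : z \in S -> tperm x y z \in S by case: tpermP => // ->.
have key u : last_in S x u -> last_in S y (f u).
  move=> /forall_inP H; apply/forall_inP => z zS.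
  by rewrite !E tpermR H // tS.
have key' u : last_in S y (f u) -> last_in S x u.
  move=> /forall_inP H; apply/forall_inP => z zS.
  by have := H _ (tS _ zS); rewrite !E tpermR tpermK.
apply/imsetP/idP => [[u]|].
  by rewrite inE => /key H ->; rewrite inE.
rewrite inE => H; exists (s * tperm x y)%g; last first.
  by rewrite /f -mulgA tperm2 mulg1.
by rewrite inE; apply: key'; rewrite /f -mulgA tperm2 mulg1.
Qed.

Lemma card_last_in (S : {set 'I_N}) (x : 'I_N) : x \in S ->
  (#|[set s | last_in S x s]| * #|S| = N`!)%N.
Proof.
move=> xS; have S0 : S != finset.set0 by apply/finset.set0Pn; exists x.
transitivity (\sum_(y in S) #|[set s | last_in S y s]|)%N.
  rewrite mulnC -sum_nat_const; apply: eq_bigr => y yS; exact: card_last_in_eq.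
transitivity (\sum_(y in S) \sum_(s : 'S_N) last_in S y s)%N.
  apply: eq_bigr => y _; rewrite -sum1_card big_mkcond /=.
  by apply: eq_bigr => s _; rewrite inE; case: last_in.
rewrite exchange_big /=; under eq_bigr do rewrite last_in_unique //.
by rewrite sum1_card card_Sn.
Qed.
End Last.

Section Offline.
Variables (R : realType) (n : nat) (p : 'I_n.+1 -> R).
Local Notation N := n.+1.

Lemma offline_ge0 s : 0 <= offline_welfare p s.
Proof.
by rewrite /offline_welfare; elim/big_rec: _ => // d x _ x0; rewrite le_max x0 orbT.
Qed.

Lemma offline_ge (s : 'S_N) (d : {ffun 'I_N -> bool}) :
  social_welfare p s d <= offline_welfare p s.
Proof.
by rewrite /offline_welfare (bigD1 d) //= le_max lexx.
Qed.

Lemma foldl_idle (s : 'S_N) (d : 'I_N -> bool) (l : seq 'I_N) h :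
  all (fun t => ~~ d t) l ->
  foldl (fun h t => trade_step (d t) (s t) h) h l = h.
Proof.
by elim: l h => //= t l IH h /andP[dt dl]; rewrite {2}/trade_step dt IH.
Qed.

Lemma offline_buyer (s : 'S_N) (a : 'I_N) : a != ord0 ->
  ((s^-1)%g ord0 < (s^-1)%g a)%N -> p a <= offline_welfare p s.
Proof.
move=> a0; set t0 := (s^-1)%g ord0; set t1 := (s^-1)%g a => t01.
have n01 : t0 != t1 by rewrite -val_eqE neq_ltn t01.
pose d := [ffun t => (t == t0) || (t == t1)].
apply: le_trans (offline_ge s d).
have ix (t : 'I_N) : index t (enum 'I_N) = t by exact: index_enum_ord.
have u0 := enum_uniq 'I_N.
have := mem_enum 'I_N t0; rewrite inE /= => t0in.
rewrite /social_welfare /final_holder.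
have t1in : t1 \in enum 'I_N by rewrite mem_enum.
case/splitPr: (enum 'I_N) / t0in ix u0 t1in => l1 l2 ix u0 t1in.
have t0l1 : t0 \notin l1.
  by move: u0; rewrite cat_uniq /= => /and3P[_ /norP[]].
have i0 := ix t0; rewrite index_cat (negbTE t0l1) /= eqxx addn0 in i0.
have t1l2 : t1 \in l2.
  move: t1in; rewrite mem_cat inE eq_sym (negbTE n01) /= => /orP[t1l1|] //.
  have := ix t1; rewrite index_cat t1l1 => i1.
  by have := index_mem t1 l1; rewrite t1l1 i1 i0 ltnNge (ltnW t01).
have t1l1 : t1 \notin l1.
  apply/negP => h; move: u0; rewrite cat_uniq /= => /and3P[_ /norP[_ /hasP[]]].
  by exists t1.
case/splitPr: l2 / t1l2 u0 {ix t1in} => l2 l3 u0.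
have idle (l : seq 'I_N) : t0 \notin l -> t1 \notin l -> all (fun t => ~~ d t) l.
  move=> h0 h1; apply/allP => t tl; rewrite ffunE negb_or.
  by apply/andP; split; [apply: contraNneq h0 => <-|apply: contraNneq h1 => <-].
move: u0; rewrite cat_uniq /= mem_cat inE cat_uniq /= !negb_or.
move=> /and3P[_ _ /andP[/and3P[t0l2 _ t0l3]]].
move=> /and4P[_ /andP[t1l2 _] t1l3 _].
have d0 : d t0 by rewrite ffunE eqxx.
have d1 : d t1 by rewrite ffunE eqxx orbT.
rewrite foldl_cat (foldl_idle _ _ (idle l1 t0l1 t1l1)) /= d0 /t0 permKV.
have S0 : trade_step true ord0 (Some ord0) = None :> option 'I_N by [].
have S1 : trade_step true a None = Some a by rewrite /trade_step /= (negbTE a0).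
rewrite S0 foldl_cat (foldl_idle _ _ (idle l2 t0l2 t1l2)) /=.
rewrite d1 /t1 permKV S1.
by rewrite (foldl_idle _ _ (idle l3 t0l3 t1l3)).
Qed.

Section Opt.
Variable k : nat.
Hypothesis kn : (k < N)%N.
Variable P : nat -> R.
Local Notation agent i := (inord (k - i) : 'I_N).
Hypothesis p_top : forall i, (i < k)%N -> p (agent i) = P i.

(** Counting the real buyers from 0 at the top: [before i] true and [before i.+1] false means that
    number [i] is the best one arriving after the seller. *)
Definition before (i : nat) (s : 'S_N) := last_in (ord0 |: [set agent j | j : 'I_i]) ord0 s.

Lemma val_agent i : val (agent i) = (k - i)%N.
Proof. by rewrite /= inordK // (leq_ltn_trans (leq_subr _ _)). Qed.

Lemma card_before i : (i <= k)%N -> (#|[set s | before i s]| * i.+1 = N`!)%N.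
Proof.
move=> ik; rewrite -(@card_last_in n (ord0 |: [set agent j | j : 'I_i]) ord0 (setU11 _ _)).
congr (_ * _)%N; rewrite cardsU1 card_imset ?card_ord.
  case: imsetP => //= -[j _ /(congr1 val)]; rewrite val_agent /=.
  by have := ltn_ord j; lia.
move=> j j' /(congr1 val); rewrite !val_agent => E; apply: val_inj => /=.
by have := ltn_ord j; have := ltn_ord j'; lia.
Qed.

Lemma before0 s : before 0 s.
Proof.
apply/forall_inP => y; rewrite !inE => /orP[/eqP->|/imsetP[[]]] //.
Qed.

Lemma beforeS i s : before i.+1 s = before i s && ((s^-1)%g (agent i) <= (s^-1)%g ord0)%N.
Proof.
apply/forall_inP/andP => [H|[/forall_inP H H']].
  split; last by apply: H; rewrite !inE; apply/orP; right; apply/imsetP; exists ord_max.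
  apply/forall_inP => y; rewrite !inE => /orP[/eqP->|/imsetP[j _ ->]] //.
  apply: H; rewrite !inE; apply/orP; right; apply/imsetP.
  by exists (widen_ord (leqnSn i) j).
move=> y; rewrite !inE => /orP[/eqP->|/imsetP[j _ ->]] //.
have [E|ji] := eqVneq (j : nat) i; first by rewrite E.
have jlt : (j < i)%N by rewrite ltn_neqAle ji -ltnS ltn_ord.
by apply: H; rewrite !inE; apply/orP; right; apply/imsetP; exists (Ordinal jlt).
Qed.

Lemma offline_before i s : (i < k)%N -> 0 <= P i ->
  P i * ((before i s)%:R - (before i.+1 s)%:R) <= offline_welfare p s.
Proof.
move=> ik P0; rewrite beforeS; case: (before i s) => /=; last first.
  by rewrite subrr mulr0 offline_ge0.
case: leqP => h; first by rewrite subrr mulr0 offline_ge0.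
rewrite subr0 mulr1 -p_top //; apply: offline_buyer => //.
by rewrite -val_eqE val_agent /= subn_eq0 -ltnNge.
Qed.

(** The events [before i] are nested, so at most one summand is nonzero, and the corresponding sale
    is feasible. *)
Lemma offline_sum q s : (q <= k)%N -> (forall i, (i < q)%N -> 0 <= P i) ->
  \sum_(0 <= i < q) P i * ((before i s)%:R - (before i.+1 s)%:R) <= offline_welfare p s.
Proof.
move=> qk P0.
have [B|nB] := boolP (before q s).
  have all_b i : (i <= q)%N -> before i s.
    move=> iq; have : before (i + (q - i)) s by rewrite subnKC.
    by elim: (q - i)%N => [|m IH]; rewrite ?addn0 // addnS beforeS => /andP[/IH].
  rewrite big_nat big1 ?offline_ge0 // => i /andP[_ iq].
  by rewrite !all_b ?(ltnW iq) // subrr mulr0.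
elim: q qk P0 nB => [|q IH] qk P0 nB; first by rewrite before0 in nB.
have [B|nB'] := boolP (before q s); last first.
  rewrite big_nat_recr //= (negbTE nB) (negbTE nB') subrr mulr0 addr0.
  by apply: IH => //; [exact: ltnW|move=> i iq; apply: P0; exact: ltnW].
rewrite big_nat_recr //= big_nat big1 ?add0r.
  by apply: offline_before => //; exact: P0.
move=> i /andP[_ iq].
have all_b j : (j <= q)%N -> before j s.
  move=> jq; have : before (j + (q - j)) s by rewrite subnKC.
  by elim: (q - j)%N => [|m IH']; rewrite ?addn0 // addnS beforeS => /andP[/IH'].
by rewrite !all_b ?(ltnW iq) // subrr mulr0.
Qed.

Lemma opt_ge q : (q <= k)%N -> (forall i, (i < q)%N -> 0 <= P i) ->
  \sum_(0 <= i < q) P i / (i.+1 * i.+2)%:R <= opt_welfare p.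
Proof.
move=> qk P0; have f0 : 0 < N`!%:R :> R by rewrite ltr0n fact_gt0.
rewrite /opt_welfare /order_mean ler_pdivlMr //.
apply: (@le_trans _ _ (\sum_(s : 'S_N) \sum_(0 <= i < q)
   P i * ((before i s)%:R - (before i.+1 s)%:R))); last first.
  by apply: ler_sum => s _; exact: offline_sum.
rewrite exchange_big /= mulr_suml le_eqVlt; apply/orP; left; apply/eqP.
apply: eq_big_nat => i /andP[_ iq].
rewrite -mulr_sumr sumrB.
have cnt j : (j <= k)%N -> \sum_(s : 'S_N) (before j s)%:R = N`!%:R / j.+1%:R :> R.
  move=> jk; rewrite -(card_before jk) natrM mulfK ?pnatr_eq0 //.
  rewrite -sum1_card natr_sum [RHS]big_mkcond /=; apply: eq_bigr => s _.
  by rewrite inE; case: before.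
rewrite !cnt; [|lia..].
have a0 : i.+1%:R != 0 :> R by rewrite pnatr_eq0.
have a1 : i.+1%:R + 1 != 0 :> R by rewrite natr1 pnatr_eq0.
rewrite natrM -[i.+2%:R]natr1; move: a0 a1; move: i.+1%:R => a a0 a1.
by field; rewrite a0 a1.
Qed.

End Opt.
End Offline.

(** * Integration over the seed *)

Section Integral.
Variables (R : realType) (d : measure_display) (T : measurableType d).
Variable (P : probability T R).

Lemma Rintegral_sum (I : Type) (s : seq I) (f : I -> T -> R) :
  (forall i, P.-integrable setT (EFin \o f i)) ->
  P.-integrable setT (EFin \o (fun x => \sum_(i <- s) f i x)) /\
  \int[P]_x (\sum_(i <- s) f i x) = \sum_(i <- s) \int[P]_x f i x.
Proof.
move=> fi; elim: s => [|i s [IH1 IH2]].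
  have E : (fun x : T => \sum_(i <- [::]) f i x) = cst 0 by apply/funext => x; rewrite big_nil.
  rewrite E big_nil Rintegral_cst // mul0r; split=> //.
  exact: finite_measure_integrable_cst.
have E : (fun x : T => \sum_(j <- i :: s) f j x) = (fun x => f i x + \sum_(j <- s) f j x).
  by apply/funext => x; rewrite big_cons.
rewrite E big_cons RintegralD // IH2; split => //.
have -> : EFin \o (fun x => f i x + \sum_(j <- s) f j x) =
  (EFin \o f i) \+ (EFin \o (fun x => \sum_(j <- s) f j x)).
  by apply/funext => x /=; rewrite EFinD.
exact: integrableD.
Qed.

Lemma Rintegral_sum_le (I : Type) (s : seq I) (f : I -> T -> R) (a : I -> R) (B : R) :
  (forall i, P.-integrable setT (EFin \o f i)) ->
  (forall x, \sum_(i <- s) a i * f i x <= B) ->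
  \sum_(i <- s) a i * \int[P]_x f i x <= B.
Proof.
move=> fi fB; pose g i x := a i * f i x.
have gi i : P.-integrable setT (EFin \o g i).
  have -> : EFin \o g i = (fun x => (a i)%:E * (EFin \o f i) x)%E.
    by apply/funext => x /=; rewrite EFinM.
  exact: integrableZl.
have [g1 g2] := Rintegral_sum s gi.
have -> : \sum_(i <- s) a i * \int[P]_x f i x = \int[P]_x (\sum_(i <- s) g i x).
  by rewrite g2; apply: eq_bigr => i _; rewrite RintegralZl.
have -> : B = \int[P]_x (cst B x).
  rewrite Rintegral_cst // [X in fine X](_ : _ = 1%E) ?mulr1 //.
  exact: probability_setT.
apply: le_Rintegral => //; first exact: finite_measure_integrable_cst.
by move=> x _; exact: fB.
Qed.

End Integral.

Section Welfare.
Variables (R : realType) (A : online_algorithm R) (n : nat) (p : 'I_n.+1 -> R).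
Variable s : 'S_n.+1.
Local Notation N := n.+1.

(** For a fixed order the welfare is a simple function of the seed: only the decisions along
    finitely many histories matter, and each decision vector defines a measurable event. *)
Lemma online_welfare_integrable :
  (seed_law A).-integrable setT (EFin \o (fun w => online_welfare p s w)).
Proof.
pose h t := history p s t.
pose E (dd : {ffun 'I_N -> bool}) : set (seed A) :=
  (\bigcap_(t in [set: 'I_N]) [set w | decide w (h t) = dd t])%classic.
have mE dd : measurable (E dd).
  apply: fin_bigcap_measurable; first exact: finite_finset.
  move=> t _; have := @measurable_decide R A (h t).
  case: (dd t) => // /measurableC.
  have -> // : (~` [set w : seed A | decide w (h t)] =
    [set w : seed A | decide w (h t) = false])%classic.
  by apply/predeqP => w /=; case: (decide w (h t)); split.
have -> : (fun w => online_welfare p s w) =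
  (fun w => \sum_(dd : {ffun 'I_N -> bool}) social_welfare p s dd * \1_(E dd) w).
  apply/funext => w; rewrite (bigD1 [ffun t => decide w (h t)]) //= big1 ?addr0.
    rewrite indicE mem_set ?mulr1; last by move=> t _ /=; rewrite ffunE.
    rewrite /online_welfare /social_welfare; congr oapp.
    rewrite /final_holder; elim: (enum 'I_N) (Some ord0) => //= t l IH hh.
    by rewrite ffunE IH.
  move=> dd ddw; rewrite indicE memNset ?mulr0 // => Ew.
  by case/eqP: ddw; apply/ffunP => t; rewrite ffunE (Ew t).
apply: (Rintegral_sum (index_enum {ffun 'I_N -> bool}) (P := seed_law A)
  (f := fun dd w => social_welfare p s dd * \1_(E dd) w) _).1 => dd.
have -> : EFin \o (fun w => social_welfare p s dd * \1_(E dd) w) =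
   (fun w => (social_welfare p s dd)%:E * (EFin \o \1_(E dd)) w)%E.
  by apply/funext => x /=; rewrite EFinM.
apply: integrableZl => //.
apply: integrable_indic => //.
Qed.

End Welfare.

(** * Sorting the buyers *)

Section Relabel.
Variables (R : realType) (n : nat) (tau : 'S_n.+1).
Hypothesis tau0 : tau ord0 = ord0.
Variable p : 'I_n.+1 -> R.
Local Notation N := n.+1.

Lemma tau_ord0 a : (tau a == ord0) = (a == ord0).
Proof. by rewrite -{1}tau0 (inj_eq perm_inj). Qed.

Lemma final_holder_relabel (s : 'S_N) d :
  final_holder (s * tau)%g d = omap tau (final_holder s d).
Proof.
rewrite /final_holder -[in LHS]tau0 -[Some (tau ord0)]/(omap tau (Some ord0)).
elim: (enum 'I_N) (Some ord0) => [|t l IH] h //=.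
rewrite -IH; congr foldl; rewrite permM /trade_step; case: (~~ d t) => //.
by case: h => [b|] /=; rewrite !tau_ord0; case: ifP.
Qed.

Lemma social_welfare_relabel (s : 'S_N) d :
  social_welfare (p \o tau) s d = social_welfare p (s * tau)%g d.
Proof. by rewrite /social_welfare final_holder_relabel; case: final_holder. Qed.

Lemma opt_welfare_relabel : opt_welfare (p \o tau) = opt_welfare p.
Proof.
rewrite /opt_welfare /order_mean; congr (_ / _).
rewrite [RHS](reindex_inj (mulIg tau)); apply: eq_bigr => s _.
by apply: eq_bigr => d _; exact: social_welfare_relabel.
Qed.

Lemma online_welfare_relabel (A : online_algorithm R) (s : 'S_N) (w : seed A) :
  online_welfare (p \o tau) s w = online_welfare p (s * tau)%g w.
Proof.
rewrite /online_welfare social_welfare_relabel; congr (social_welfare _ _ _).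
apply/funext => t; congr (decide w _); apply: eq_map => u.
by rewrite /report permM /= tau_ord0.
Qed.

(** Reports do not disclose which buyer arrives and the order is uniform, so buyers may be sorted by
    price after the hard instance has been found. *)
Lemma alg_welfare_relabel (A : online_algorithm R) :
  alg_welfare A (p \o tau) = alg_welfare A p.
Proof.
rewrite /alg_welfare /order_mean; congr (_ / _).
rewrite [RHS](reindex_inj (mulIg tau)); apply: eq_bigr => s _.
by apply: eq_Rintegral => w _; exact: online_welfare_relabel.
Qed.

End Relabel.

Lemma sort_buyers (n : nat) (q : 'I_n -> nat) : injective q ->
  exists sigma : 'S_n, forall i j : 'I_n, (i < j)%N -> (q (sigma j) < q (sigma i))%N.
Proof.
move=> qI; pose t := [tuple q i | i < n].
have pe : perm_eq (sort geq t) t by exact/permEl/perm_sort.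
have /tuple_permP[sigma E] := pe.
exists sigma => i j ij.
have qs k : nth 0%N (sort geq t) (k : 'I_n) = q (sigma k).
  by rewrite E -tnth_nth !tnth_mktuple.
rewrite -!qs.
have srt : sorted gtn (sort geq t).
  have tot : total geq by move=> x y; exact: leq_total.
  have u : uniq (sort geq t).
    rewrite sort_uniq (map_inj_uniq qI); exact: enum_uniq.
  have := sort_sorted tot t; move: (sort geq t) u => l.
  case: l => //= x l; elim: l x => //= y l IH x /andP[xl ul] /andP[yx pl].
  rewrite IH // andbT ltn_neqAle yx andbT.
  by move: xl; rewrite inE negb_or eq_sym => /andP[].
have sz : size (sort geq t) = n by rewrite size_sort size_tuple.
have tr : transitive gtn by move=> x y z /= h1 h2; exact: ltn_trans h2 h1.
by apply: (sorted_ltn_nth tr 0%N srt) => //; rewrite inE sz.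
Qed.

(** * Averaging over seeds, levels and dummies *)

Lemma holding_gain_ge0 (R : realFieldType) (T : Type) (D : seq T -> bool) (rb rd : nat -> T)
  (v : nat -> R) (c : R) N K m U hist : 0 <= c -> (forall i, 0 <= v i) ->
  0 <= holding_gain D rb rd v c N K m U hist.
Proof.
move=> c0 v0; elim: m U hist => //= m IH U hist; apply: addr_ge0.
  by case: (D _) => //; rewrite !mulr_ge0 ?exprn_ge0 ?tfrac_ge0.
rewrite mulr_ge0 ?invr_ge0 // sumr_ge0 // => j _.
by case: (D _) => //; rewrite !mulr_ge0 ?exprn_ge0 ?tfrac_ge0.
Qed.

Lemma waiting_gain_ge0 (R : realFieldType) (T : Type) (D : seq T -> bool) rs (rb rd : nat -> T)
  (v : nat -> R) (c : R) N K m U hist : 0 <= c -> (forall i, 0 <= v i) ->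
  0 <= waiting_gain D rs rb rd v c N K m U hist.
Proof.
move=> c0 v0; elim: m U hist => //= m IH U hist; rewrite !addr_ge0 //.
  by rewrite mulr_ge0 ?invr_ge0 // sumr_ge0.
by rewrite mulr_ge0 ?invr_ge0 // holding_gain_ge0.
Qed.

Lemma ffact_ge (R : realFieldType) (N j : nat) : (0 < N)%N -> (j <= N)%N ->
  N%:R ^+ j * (1 - j%:R ^+ 2 / N%:R) <= (N ^_ j)%:R :> R.
Proof.
move=> N0; have Np : 0 < N%:R :> R by rewrite ltr0n.
elim: j => [|j IH] jN; first by rewrite expr0 mul1r expr0n mul0r subr0 ffactn0.
rewrite ffactnSr natrM natrB 1?ltnW //.
have := ler_wpM2r (_ : 0 <= N%:R - j%:R :> R) (IH (ltnW jN)).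
rewrite subr_ge0 ler_nat => /(_ (ltnW jN)); apply: le_trans.
have -> : N%:R ^+ j * (1 - j%:R ^+ 2 / N%:R) * (N%:R - j%:R) =
   N%:R ^+ j.+1 * ((1 - j%:R ^+ 2 / N%:R) * (1 - j%:R / N%:R)) :> R.
  by rewrite [N%:R ^+ j.+1]exprS; field; rewrite gt_eqF.
rewrite ler_wpM2l ?exprn_ge0 ?ler0n // -natr1.
set x := N%:R^-1; have x0 : 0 <= x by rewrite invr_ge0 ler0n.
have j0 : 0 <= j%:R :> R by rewrite ler0n.
have := mulr_ge0 (mulr_ge0 j0 x0) (mulr_ge0 (mulr_ge0 j0 j0) x0).
have := mulr_ge0 j0 x0; lra.
Qed.

(** The cost of letting agents share slots: a power of [N] replaces a falling factorial, with
    relative error about (K + 1)^2 / N. *)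
Lemma fact_ratio (R : realType) (n K : nat) : (K <= n)%N ->
  K.+1%:R ^+ 2 / n.+1%:R <= 10 ^- 10 :> R ->
  (n - K)`!%:R * n.+1%:R ^+ K.+1 <= (n.+1)`!%:R * (1 + 10 ^- 9) :> R.
Proof.
move=> Kn small; have KN : (K.+1 <= n.+1)%N by [].
rewrite -(ffact_fact KN) subSS natrM.
have := @ffact_ge R n.+1 K.+1 (ltn0Sn _) KN.
set x := _ / _ in small *; set F := (_ ^_ _)%:R; set Q := _ ^+ K.+1 => H.
have Q0 : 0 <= Q by rewrite exprn_ge0 // ler0n.
have f0 : 0 <= (n - K)`!%:R :> R by rewrite ler0n.
rewrite [F * _]mulrC -mulrA; apply: ler_wpM2l => //.
have : Q * (10 ^- 10 - x) >= 0 by rewrite mulr_ge0 // subr_ge0.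
lra.
Qed.

Section Average.
Variables (R : realType) (A : online_algorithm R) (n L M : nat).
Local Notation N := n.+1.
Local Notation b := 46%N.
Local Notation c := (46^-1 : R).
Hypothesis L0 : (0 < L)%N.
Hypothesis Ln : (L <= n)%N.
Hypothesis small : L.+1%:R ^+ 2 / N%:R <= 10 ^- 10 :> R.
Hypothesis M_large : N%:R <= 10 ^- 8 * b%:R ^+ M :> R.
Local Notation theta K := (b%:R ^+ (M + K) : R).
Local Notation price K z := (fun a : 'I_N => (hard_price K M b z a)%:R : R).

Definition game_total : R :=
  L.+1%:R * 10 ^- 10 + 2 * 10 ^+ 10 + L%:R * (285 / 10 ^+ 3 + 784 / 10 ^+ 6).

Lemma dummy_value_le (z : 'S_N) i : 0 <= dummy_value R M b z i <= 10 ^- 8.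
Proof.
have bM : 0 < b%:R ^+ M :> R by rewrite exprn_gt0.
apply/andP; split; first by rewrite divr_ge0 // ltW.
rewrite ler_pdivrMr //; apply: le_trans M_large.
by rewrite ler_nat ltnW.
Qed.

Lemma game_total_ge (w : seed A) (z : 'S_N) :
  \sum_(0 <= K < L.+1) waiting_gain (decide w) (seller_report R) (level_report R M b)
     (dummy_report R z) (dummy_value R M b z) c N K N (iota 1 K) [::] <= game_total.
Proof.
have e0 : 0 < (10 ^+ 10)^-1 :> R by rewrite invr_gt0 exprn_gt0.
have LN : L%:R * N%:R^-1 <= 10 ^- 10 :> R.
  apply: le_trans small; rewrite ler_wpM2r ?invr_ge0 ?ler0n //.
  rewrite expr2 -natrM ler_nat; lia.
have := game_bound (ltn0Sn n) L0 LN (decide w) (seller_report R) (level_report R M b)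
  (dummy_report R z) (dummy_value_le z) [::] e0.
by rewrite invrK.
Qed.

Lemma seed_average (w : seed A) :
  \sum_(1 <= K < L.+1) \sum_(z : 'S_N) \sum_(s : 'S_N)
     (theta K)^-1 * online_welfare (price K z) s w <=
  N`!%:R * N`!%:R * (1 + 10 ^- 9) * game_total.
Proof.
have v0 (z : 'S_N) i : 0 <= dummy_value R M b z i by case/andP: (dummy_value_le z i).
have c0 : 0 <= c by rewrite invr_ge0.
pose G K (z : 'S_N) := waiting_gain (decide w) (seller_report R) (level_report R M b)
     (dummy_report R z) (dummy_value R M b z) c N K N (iota 1 K) [::].
have G0 K z : 0 <= G K z by apply: waiting_gain_ge0 => //; exact: v0.
apply: (@le_trans _ _ (\sum_(1 <= K < L.+1) (N`!%:R * (1 + 10 ^- 9)) * \sum_(z : 'S_N) G K z)).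
  rewrite big_nat [leRHS]big_nat ler_sum // => K /andP[K1 KL].
  have Kn : (K <= n)%N by apply: leq_trans Ln.
  have t0 : 0 < theta K by rewrite exprn_gt0.
  have := @sum_welfare_le R n K M b A w isT Kn; rewrite -/(G K _).
  have -> : \sum_(z : 'S_N) \sum_(s : 'S_N) (theta K)^-1 * online_welfare (price K z) s w =
     (theta K)^-1 * \sum_(z : 'S_N) \sum_(s : 'S_N) online_welfare (price K z) s w.
    by rewrite mulr_sumr; apply: eq_bigr => z _; rewrite mulr_sumr.
  rewrite -mulrA => H.
  rewrite mulrC ler_pdivrMr // [leRHS]mulrC; apply: le_trans H _.
  rewrite ler_wpM2l ?(ltW t0) //; apply: ler_wpM2r.
    by apply: sumr_ge0 => z _; exact: G0.
  apply: fact_ratio => //; apply: le_trans small.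
  by rewrite ler_wpM2r ?invr_ge0 ?ler0n // lerXn2r ?nnegrE ?ler0n // ler_nat.
rewrite -mulr_sumr exchange_big /=.
have -> : N`!%:R * N`!%:R * (1 + 10 ^- 9) * game_total =
   N`!%:R * (1 + 10 ^- 9) * (N`!%:R * game_total) by ring.
have f0 : 0 <= N`!%:R * (1 + 10 ^- 9) :> R.
  by apply: mulr_ge0; [rewrite ler0n|apply: addr_ge0; rewrite ?invr_ge0 ?exprn_ge0].
rewrite ler_wpM2l //.
have -> : N`!%:R * game_total = \sum_(z : 'S_N) game_total.
  by rewrite sumr_const mulr_natl; congr (_ *+ _); exact: esym (card_Sn N).
apply: ler_sum => z _; apply: le_trans (game_total_ge w z).
(* The game sums from [K = 0], where no real buyer exists; that nonnegative term is discarded. *)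
by rewrite [leRHS]big_ltn // lerDr G0.
Qed.

Lemma alg_average :
  \sum_(1 <= K < L.+1) \sum_(z : 'S_N) (theta K)^-1 * alg_welfare A (price K z) <=
  N`!%:R * (1 + 10 ^- 9) * game_total.
Proof.
have f0 : 0 < N`!%:R :> R by rewrite ltr0n fact_gt0.
(* A flat list of triples, so that the bound valid for every seed is integrated in one application
   of [Rintegral_sum_le]. *)
pose idx := [seq (K, zs) | K <- index_iota 1 L.+1, zs <- index_enum ('S_N * 'S_N)%type].
have := @Rintegral_sum_le R _ _ (seed_law A) _ idx
  (fun i w => online_welfare (price i.1 i.2.1) i.2.2 w)
  (fun i => (theta i.1)^-1) _
  (fun i => online_welfare_integrable A (price i.1 i.2.1) i.2.2) .
move=> /(_ (N`!%:R * N`!%:R * (1 + 10 ^- 9) * game_total)).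
have unf (F : nat -> 'S_N -> 'S_N -> R) : \sum_(i <- idx) F i.1 i.2.1 i.2.2 =
  \sum_(1 <= K < L.+1) \sum_(z : 'S_N) \sum_(s : 'S_N) F K z s.
  rewrite big_allpairs_dep /=; apply: eq_bigr => K _.
  by rewrite pair_bigA.
have H (w : seed A) :
  \sum_(i <- idx) (theta i.1)^-1 * online_welfare (price i.1 i.2.1) i.2.2 w <=
   N`!%:R * N`!%:R * (1 + 10 ^- 9) * game_total.
  rewrite (unf (fun K z s => (theta K)^-1 * online_welfare (price K z) s w)).
  exact: seed_average.
move=> /(_ H).
rewrite (unf (fun K z s => (theta K)^-1 * \int[seed_law A]_w online_welfare (price K z) s w)).
move=> B; rewrite -(ler_pM2l f0) !mulrA; apply: le_trans B.
rewrite mulr_sumr le_eqVlt; apply/orP; left; apply/eqP.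
apply: eq_bigr => K _; rewrite mulr_sumr; apply: eq_bigr => z _.
rewrite /alg_welfare /order_mean -mulr_sumr mulrCA; congr (_ * _).
by rewrite mulrC divfK // gt_eqF.
Qed.

Lemma alg_welfare_ge0 (p : 'I_N -> R) : (forall a, 0 <= p a) -> 0 <= alg_welfare A p.
Proof.
move=> p0; rewrite /alg_welfare /order_mean divr_ge0 ?ler0n // sumr_ge0 // => s _.
apply: Rintegral_ge0 => w _; rewrite /online_welfare /social_welfare.
by case: final_holder => //= a; exact: p0.
Qed.

Lemma opt_price_ge (K : nat) (z : 'S_N) : (4 <= K <= L)%N ->
  theta K * (1 / 2 + c / 6 + c ^+ 2 / 12 + c ^+ 3 / 20) <= opt_welfare (price K z).
Proof.
move=> /andP[K4 KL]; have KN : (K < N)%N by rewrite ltnS (leq_trans KL).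
pose P i : R := theta K * c ^+ i.
have P0 i : (i < 4)%N -> 0 <= P i by rewrite mulr_ge0 ?exprn_ge0 // invr_ge0.
have pt i : (i < K)%N -> price K z (inord (K - i)) = P i.
  move=> iK; have v : (inord (K - i) : 'I_N) = (K - i)%N :> nat.
    by rewrite inordK // (leq_ltn_trans (leq_subr _ _)).
  have nz : inord (K - i) != ord0 :> 'I_N.
    by apply/eqP => /(congr1 val) /=; rewrite v; lia.
  rewrite /hard_price (negbTE nz) v leq_subr.
  rewrite natrX /P exprVn.
  have -> : (M + K = M + (K - i) + i)%N by rewrite -addnA subnK // ltnW.
  by rewrite [b%:R ^+ (_ + i)]exprD mulfK // expf_eq0 pnatr_eq0 andbF.
have := @opt_ge R n (price K z) K KN P pt 4 K4 P0; apply: le_trans.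
rewrite unlock /= /P !mulnE /=.
set t := theta K; lra.
Qed.

(** Otherwise the averages over [K] and [z] contradict each other. The term 2 * 10^10 of
    [game_total] and the lost values [K < 4] cost about 3.5 * 10^10 in all; against the small margin
    per [K], 10^18 values outweigh this. *)
Lemma exists_hard_price : 10 ^+ 18 <= L%:R :> R ->
  exists K (z : 'S_N), (4 <= K <= L)%N /\
    (176 / 10 ^+ 2 + 239 / 10 ^+ 5) * alg_welfare A (price K z) <=
      opt_welfare (price K z).
Proof.
move=> Lbig; apply: contrapT => H.
set r : R := 176 / 10 ^+ 2 + 239 / 10 ^+ 5.
have r0 : 0 < r by rewrite /r; lra.
have lt K z : (4 <= K <= L)%N -> opt_welfare (price K z) <= r * alg_welfare A (price K z).
  move=> KL; rewrite leNgt; apply/negP => h; apply: H.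
  by exists K, z; split => //; exact: ltW.
set Th : R := 1 / 2 + c / 6 + c ^+ 2 / 12 + c ^+ 3 / 20.
have f0 : 0 < N`!%:R :> R by rewrite ltr0n fact_gt0.
have t0 K : 0 < theta K by rewrite exprn_gt0.
have low : \sum_(4 <= K < L.+1) \sum_(z : 'S_N) Th <=
    r * \sum_(1 <= K < L.+1) \sum_(z : 'S_N) (theta K)^-1 * alg_welfare A (price K z).
  apply: (@le_trans _ _ (\sum_(4 <= K < L.+1)
     r * \sum_(z : 'S_N) (theta K)^-1 * alg_welfare A (price K z))).
    rewrite big_nat [leRHS]big_nat ler_sum // => K KL.
    rewrite mulr_sumr ler_sum // => z _; rewrite mulrCA mulrC ler_pdivlMr // mulrC.
    by apply: le_trans (lt K z KL); exact: opt_price_ge.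
  rewrite -mulr_sumr ler_wpM2l ?(ltW r0) //.
  have L4 : (4 <= L.+1)%N.
    have : 4%:R <= L.+1%:R :> R by rewrite -natr1; lra.
    by rewrite ler_nat.
  rewrite [leRHS](big_cat_nat _ (n := 4)) //= lerDr sumr_ge0 // => K _.
  rewrite sumr_ge0 // => z _; rewrite mulr_ge0 ?invr_ge0 ?(ltW (t0 _)) //.
  by apply: alg_welfare_ge0 => a; exact: ler0n.
have := le_trans low (ler_wpM2l (ltW r0) alg_average).
have -> : \sum_(4 <= K < L.+1) \sum_(z : 'S_N) Th = N`!%:R * ((L.+1 - 4)%:R * Th).
  rewrite sumr_const_nat sumr_const -mulrnA mulnC mulrnA -[X in X = _]mulr_natl.
  have -> : #|'S_N| = N`! by exact: card_Sn.
  by rewrite -[_ *+ (_ - _)]mulr_natl.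
have -> : r * (N`!%:R * (1 + 10 ^- 9) * game_total) = N`!%:R * (r * (1 + 10 ^- 9) * game_total).
  by ring.
rewrite ler_pM2l // leNgt => /negP; apply.
have : (L.+1 - 4)%:R >= L%:R - 3 :> R.
  rewrite subSS lerBlDr -natrD ler_nat; lia.
move=> L3; have Th0 : 0 < Th by rewrite /Th; lra.
apply: (@lt_le_trans _ _ ((L%:R - 3) * Th)); last by rewrite ler_wpM2r // ltW.
rewrite /game_total -[L.+1%:R]natr1 /r /Th; move: Lbig.
move: L%:R => l lb; lra.
Qed.
End Average.

Lemma hard_price_inj (n K M b : nat) (z : 'S_n.+1) : (1 < b)%N -> (n < b ^ M)%N ->
  injective (fun i : 'I_n => hard_price K M b z (lift ord0 i)).
Proof.
move=> b1 nM i j; rewrite /hard_price ![lift _ _ == _]eq_sym !(negbTE (neq_lift _ _)).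
have big a (x : 'I_n.+1) : (z x < b ^ (M + a))%N.
  apply: leq_trans (ltn_ord _) (leq_trans nM _).
  by rewrite leq_exp2l // leq_addr.
case: ifP => iK; case: ifP => jK.
- by move/(expnI b1)/addnI => /val_inj /lift_inj.
- by move=> E; have := big (lift ord0 i : nat) (lift ord0 j); rewrite E ltnn.
- by move=> E; have := big (lift ord0 j : nat) (lift ord0 i); rewrite E ltnn.
by move/val_inj/perm_inj/lift_inj.
Qed.

Theorem theorem4p5 (R : realType) (ALG : nat -> online_algorithm R)
    (delta : R) (hdelta : 0 < delta) :
  exists n0 : nat, forall n : nat, (n0 <= n)%N ->
  exists X : 'I_n -> nat,
    (forall i j : 'I_n, (i < j)%N -> (X j < X i)%N) /\
    let p := agent_prices 0 (fun i : 'I_n => (X i)%:R : R) in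
    ((176 / 10 ^+ 2 + 239 / 10 ^+ 5 - delta)%:E
       <= welfare_ratio (opt_welfare p) (alg_welfare (ALG n) p))%E.
Proof.
have [L Lbig] : exists L : nat, 10 ^+ 18 <= L%:R :> R.
  by exists (Num.bound (10 ^+ 18 : R)); apply: ltW; apply: archi_boundP; exact: exprn_ge0.
have L0 : (0 < L)%N.
  by rewrite -(ltr0n R); apply: lt_le_trans Lbig; exact: exprn_gt0.
(* [L] is fixed before [n]; taking [n] at least (L + 1)^2 * 10^10 makes both the mesh and the
   overcounting of shared slots negligible. *)
pose n0 := Num.bound (L.+1%:R ^+ 2 * 10 ^+ 10 : R).
have n0P : L.+1%:R ^+ 2 * 10 ^+ 10 <= n0%:R :> R.
  by apply/ltW/archi_boundP; rewrite mulr_ge0 ?exprn_ge0.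
exists (maxn L n0) => n; rewrite geq_max => /andP[Ln n0n].
(* Since 46^M exceeds [M], every dummy is worth at most 10^-8 times 46^M, the [eta] of the
   potential. *)
pose M := Num.bound (10 ^+ 8 * n.+1%:R : R).
have small : L.+1%:R ^+ 2 / n.+1%:R <= 10 ^- 10 :> R.
  rewrite ler_pdivrMr ?ltr0n // mulrC ler_pdivlMr ?exprn_gt0 //.
  by apply: le_trans n0P _; rewrite ler_nat ltnW.
have MP : n.+1%:R <= 10 ^- 8 * 46 ^+ M :> R.
  rewrite mulrC ler_pdivlMr ?exprn_gt0 // mulrC.
  apply: (@le_trans _ _ M%:R).
    by apply/ltW/archi_boundP; rewrite mulr_ge0 ?exprn_ge0.
  by rewrite -natrX ler_nat ltnW // ltn_expl.
have nM : (n < 46 ^ M)%N.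
  rewrite -(ler_nat R) natrX; apply: le_trans MP _.
  by rewrite ler_piMl ?exprn_ge0 // invf_le1 ?exprn_gt0 // exprn_ege1 // ler1n.
have [K [z [KL good]]] := exists_hard_price (ALG n) L0 Ln small MP Lbig.
have qI := @hard_price_inj n K M 46 z isT nM.
have [sigma dec] := sort_buyers qI.
exists (fun i => hard_price K M 46 z (lift ord0 (sigma i))); split; first exact: dec.
set p := agent_prices _ _.
pose tau := lift_perm ord0 ord0 sigma.
have -> : p = (fun a => (hard_price K M 46 z a)%:R : R) \o tau.
  apply/funext => a; rewrite /p /agent_prices /=.
  case: unliftP => [i ->|->] /=; first by rewrite lift_perm_lift.
  by rewrite lift_perm_id /hard_price eqxx.
have tau0 : tau ord0 = ord0 by exact: lift_perm_id.
rewrite /= opt_welfare_relabel // alg_welfare_relabel // /welfare_ratio.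
have a0 : 0 <= alg_welfare (ALG n) (fun a => (hard_price K M 46 z a)%:R).
  by apply: alg_welfare_ge0 => a; exact: ler0n.
case: eqP => [_|/eqP an0]; first exact: leey.
rewrite lee_fin ler_pdivlMr ?lt0r ?an0 //; apply: le_trans good.
by rewrite ler_wpM2r // lerBlDr lerDl ltW.
Qed.
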